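(* The set $\Omega=\{(\tau(A),\rho(A)): A\in\mathcal{C}\}\subset\mathbb{R}^2$ is compact and simply connected.
   Context: $\mathcal{C}$ denotes the family of all two-dimensional copulas. For $A\in\mathcal{C}$, $\mu_A$ is the corresponding doubly stochastic measure on $[0,1]^2$, determined by $\mu_A([0,x]\times[0,y])=A(x,y)$. Kendall's $\tau$ and Spearman's $\rho$ of $A$ are $$\tau(A)=4\int_{[0,1]^2}A(x,y)\,d\mu_A(x,y)-1,\qquad \rho(A)=12\int_{[0,1]^2}xy\,d\mu_A(x,y)-3.$$ *)

(* Defs.v *)
From HB Require Import structures.
From mathcomp Require Import all_boot all_order all_algebra.
From mathcomp Require Import all_classical all_reals all_analysis.

Set Implicit Arguments.
Unset Strict Implicit.
Unset Printing Implicit Defensive.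
Import Order.TTheory GRing.Theory Num.Theory.
Import numFieldNormedType.Exports.

Local Open Scope classical_set_scope.
Local Open Scope ring_scope.

Definition unit_interval (R : realType) : set R := `[0, 1]%classic.
Arguments unit_interval R : clear implicits.

Definition unit_square (R : realType) : set (R * R) :=
  unit_interval R `*` unit_interval R.
Arguments unit_square R : clear implicits.

(* A copula is a function on the unit square; it is represented by a function
   on the whole plane, whose values outside the unit square are irrelevant. *)
Record is_copula (R : realType) (A : R -> R -> R) : Prop := {
  copula_range : forall x y : R, unit_interval R x -> unit_interval R y ->
    unit_interval R (A x y);
  copula_x0 : forall x : R, unit_interval R x -> A x 0 = 0;
  copula_0y : forall y : R, unit_interval R y -> A 0 y = 0;
  copula_x1 : forall x : R, unit_interval R x -> A x 1 = x;
  copula_1y : forall y : R, unit_interval R y -> A 1 y = y;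
  copula_2increasing : forall x1 x2 y1 y2 : R,
    0 <= x1 -> x1 <= x2 -> x2 <= 1 -> 0 <= y1 -> y1 <= y2 -> y2 <= 1 ->
    0 <= A x2 y2 - A x1 y2 - A x2 y1 + A x1 y1
}.

Definition planeT (R : realType) : measurableType _ :=
  (measurableTypeR R * measurableTypeR R)%type.

(* The total mass being 1 = A 1 1, such a measure is carried by the square. *)
Definition is_copula_measure (R : realType) (A : R -> R -> R)
    (mu : probability (planeT R) R) : Prop :=
  forall x y : R, unit_interval R x -> unit_interval R y ->
    mu (`[0, x]%classic `*` `[0, y]%classic) = (A x y)%:E.

(* The measure mu_A determined by A. For a copula A there is exactly one measure
   satisfying [is_copula_measure A]; the default value (the Dirac mass at the
   origin) only serves to make the definition total. *)
Definition copula_measure (R : realType) (A : R -> R -> R) :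
    probability (planeT R) R :=
  xget (dirac ((0, 0) : planeT R) : probability (planeT R) R)
    [set mu | is_copula_measure A mu].

Definition kendall_tau (R : realType) (A : R -> R -> R) : R :=
  4 * \int[copula_measure A]_(p in unit_square R) (A p.1 p.2) - 1.

Definition spearman_rho (R : realType) (A : R -> R -> R) : R :=
  12 * \int[copula_measure A]_(p in unit_square R) (p.1 * p.2) - 3.

Definition tau_rho_region (R : realType) : set (R * R) :=
  [set (kendall_tau A, spearman_rho A) | A in [set A | is_copula A]].
Arguments tau_rho_region R : clear implicits.

(* Paths and homotopies are represented by functions on R and R * R, of which
   only the restriction to the unit interval or unit square matters. *)
Definition is_path (R : realType) (T : topologicalType) (X : set T) (x y : T)
    (f : R -> T) : Prop :=
  [/\ {within unit_interval R, continuous f},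
      f @` unit_interval R `<=` X, f 0 = x & f 1 = y].

Definition path_connected (R : realType) (T : topologicalType) (X : set T) :
    Prop :=
  X !=set0 /\
  forall x y, X x -> X y -> exists f : R -> T, is_path X x y f.
Arguments path_connected R {T} X.

Definition null_homotopic (R : realType) (T : topologicalType) (X : set T)
    (x : T) (f : R -> T) : Prop :=
  exists H : R * R -> T,
    [/\ {within unit_square R, continuous H},
        H @` unit_square R `<=` X,
        forall t, unit_interval R t -> H (0, t) = f t,
        forall t, unit_interval R t -> H (1, t) = x
      & forall s, unit_interval R s -> H (s, 0) = x /\ H (s, 1) = x].

Definition simply_connected (R : realType) (T : topologicalType) (X : set T) :
    Prop :=
  path_connected R X /\
  forall (x : T) (f : R -> T), X x -> is_path X x x f -> null_homotopic X x f.
Arguments simply_connected R {T} X.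

(* Main.v *)
Require Import Defs.
From HB Require Import structures.
From mathcomp Require Import all_boot all_order all_algebra.
From mathcomp Require Import all_classical all_reals all_analysis.
From mathcomp Require Import measurable_realfun lra.
Import Order.TTheory GRing.Theory Num.Theory.
Import numFieldNormedType.Exports.

Set Implicit Arguments.
Unset Strict Implicit.
Unset Printing Implicit Defensive.
Local Open Scope classical_set_scope.
Local Open Scope ring_scope.

(** The region is compact because it is a continuous image of a compact space.
    Copulas, restricted to the unit square, form a closed subset of a product
    of unit intervals, hence a compact space for pointwise convergence
    (Tychonoff, [compact_copula_set]).  If [h] is 1-Lipschitz in each variable
    on the square, then the integral of [h] against mu_A differs by at most
    [2 / n] from the Riemann sum over the grid of mesh [1 / n]
    ([riemann_approx]), and that sum is a polynomial in finitely many values of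
    [A] and [h].  Both integrands [A x y] and [x * y] are Lipschitz, so tau and
    rho are uniform limits of continuous functions of [A].  The same estimate
    shows that these integrals depend on [A] only
    ([square_lipschitz_integral_unique]).

    The region is contractible by ordinal sums.  Let [M] be the minimum copula.
    For [s] in [0, 1], shrink [A] into the square of side [s] and put [M] on
    the rest of the diagonal.  The measure of this ordinal sum [A_s] is [s]
    times the image of mu_A under the homothety of ratio [s], plus a measure on
    the diagonal that does not depend on [A].  Hence the integral of [A_s]
    against its own measure is [s ^ 2] times that of [A] plus a constant, and
    the integral of [x * y] is [s ^ 3] times that for [A] plus a constant.
    Since [M_s = M], the constants cancel in the differences
      [tau (A_s) - tau M = s ^ 2 (tau A - tau M)] and
      [rho (A_s) - rho M = s ^ 3 (rho A - rho M)].
    These formulas define a contraction of the region to the image of [M]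
    which stays in the region ([contract_region]); an explicit homotopy turns
    it into a base-point preserving null-homotopy of every loop.

    All of this uses that mu_A exists ([copula_measure_ex]).  It is obtained by
    conditioning: for each [y], the increasing Lipschitz function [A _ y] has a
    Lebesgue-Stieltjes measure dominated by the uniform law, and its
    Radon-Nikodym density at [x] is the conditional distribution function of
    the second coordinate at [y] given the first coordinate [x].  If [X] and [V]
    are independent and uniform, then [X] together with the conditional
    quantile of level [V] has joint distribution function [A]. *)

(** * Extension of a copula to the plane *)

Section clamp.
Context {R : realType}.
Implicit Types x y : R.

Definition clamp x : R := Num.max 0 (Num.min x 1).

Lemma clampP x : [\/ x <= 0 /\ clamp x = 0, [/\ 0 <= x, x <= 1 & clamp x = x]
  | 1 <= x /\ clamp x = 1].
Proof.
rewrite /clamp; case: (leP x 1) => x1; last first.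
  by apply: Or33; split; [exact: ltW|rewrite max_r].
case: (leP x 0) => x0; first by apply: Or31.
by apply: Or32; split => //; exact: ltW.
Qed.

Lemma clamp_itv x : unit_interval R (clamp x).
Proof.
rewrite /unit_interval /= in_itv /=.
by case: (clampP x) => [[? ->]|[? ? ->]|[? ->]]; apply/andP; split; lra.
Qed.

Lemma clamp_ge0 x : 0 <= clamp x.
Proof. by have := clamp_itv x; rewrite /unit_interval /= in_itv /= => /andP[]. Qed.

Lemma clamp_le1 x : clamp x <= 1.
Proof. by have := clamp_itv x; rewrite /unit_interval /= in_itv /= => /andP[]. Qed.

Lemma clamp_id x : 0 <= x -> x <= 1 -> clamp x = x.
Proof. by move=> x0 x1; rewrite /clamp min_l// max_r. Qed.

Lemma clamp_unit x : unit_interval R x -> clamp x = x.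
Proof. by rewrite /unit_interval /= in_itv /= => /andP[]; exact: clamp_id. Qed.

Lemma clamp_le0 x : x <= 0 -> clamp x = 0.
Proof. by move=> x0; rewrite /clamp min_l ?max_l//; lra. Qed.

Lemma clamp_ge1 x : 1 <= x -> clamp x = 1.
Proof. by move=> x1; rewrite /clamp min_r ?max_r//. Qed.

Lemma clamp_nd x y : x <= y -> clamp x <= clamp y.
Proof.
move=> xy.
by case: (clampP x) => [[? ->]|[? ? ->]|[? ->]];
   case: (clampP y) => [[? ->]|[? ? ->]|[? ->]]; lra.
Qed.

Lemma clamp_lip x y : `|clamp x - clamp y| <= `|x - y|.
Proof.
wlog xy : x y / x <= y.
  by case: (leP x y) => [xy /(_ _ _ xy)//|/ltW xy /(_ _ _ xy)]; rewrite distrC (distrC y).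
rewrite !(distrC x) (distrC (clamp x)) !ger0_norm ?subr_ge0 ?clamp_nd//.
by case: (clampP x) => [[? ->]|[? ? ->]|[? ->]];
   case: (clampP y) => [[? ->]|[? ? ->]|[? ->]]; lra.
Qed.

Lemma continuous_clamp : continuous (clamp : R -> R).
Proof.
move=> x; apply/cvgrPdist_lt => e e0; near=> y.
apply: le_lt_trans (clamp_lip _ _) _.
by near: y; apply: cvgr_dist_lt => //; exact: cvg_id.
Unshelve. all: by end_near. Qed.

End clamp.

Section extension.
Context {R : realType}.
Variables (A : R -> R -> R) (cA : is_copula A).
Implicit Types x y : R.

(** Precomposing with the projection onto the unit interval keeps monotonicity,
    2-increasingness and the Lipschitz bounds, now for all real arguments, so
    that boxes and intervals need no case analysis at the border of the square. *)
Definition extend A x y : R := A (clamp x) (clamp y).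
Local Notation B := (extend A).

Lemma extendE x y : unit_interval R x -> unit_interval R y -> B x y = A x y.
Proof. by move=> x01 y01; rewrite /extend !clamp_unit. Qed.

Lemma extend_volume_ge0 x1 x2 y1 y2 : x1 <= x2 -> y1 <= y2 ->
  0 <= B x2 y2 - B x1 y2 - B x2 y1 + B x1 y1.
Proof.
by move=> x12 y12; apply: (copula_2increasing cA); rewrite ?clamp_ge0 ?clamp_le1 ?clamp_nd.
Qed.

Lemma extend_x0 x y : y <= 0 -> B x y = 0.
Proof. by move=> y0; rewrite /extend (clamp_le0 y0) (copula_x0 cA)//; exact: clamp_itv. Qed.

Lemma extend_0y x y : x <= 0 -> B x y = 0.
Proof. by move=> x0; rewrite /extend (clamp_le0 x0) (copula_0y cA)//; exact: clamp_itv. Qed.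

Lemma extend_x1 x y : 1 <= y -> B x y = clamp x.
Proof. by move=> y1; rewrite /extend (clamp_ge1 y1) (copula_x1 cA)//; exact: clamp_itv. Qed.

Lemma extend_1y x y : 1 <= x -> B x y = clamp y.
Proof. by move=> x1; rewrite /extend (clamp_ge1 x1) (copula_1y cA)//; exact: clamp_itv. Qed.

(** Monotonicity is 2-increasingness on a rectangle whose other side starts at a
    point where the copula vanishes. *)
Lemma extend_ndl x1 x2 y : x1 <= x2 -> B x1 y <= B x2 y.
Proof.
move=> x12; have := extend_volume_ge0 x12 (_ : Num.min y 0 <= y).
rewrite !(extend_x0 _ (_ : Num.min y 0 <= 0)) ?ge_min ?lexx ?orbT// => /(_ isT); lra.
Qed.

Lemma extend_ndr x y1 y2 : y1 <= y2 -> B x y1 <= B x y2.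
Proof.
move=> y12; have := extend_volume_ge0 (_ : Num.min x 0 <= x) y12.
rewrite !(extend_0y _ (_ : Num.min x 0 <= 0)) ?ge_min ?lexx ?orbT// => /(_ isT); lra.
Qed.

(** Here the rectangle is extended up to the ordinate 1, where the copula is the
    first coordinate. *)
Lemma extend_incrl x1 x2 y : x1 <= x2 -> B x2 y - B x1 y <= clamp x2 - clamp x1.
Proof.
move=> x12; have := extend_volume_ge0 x12 (_ : y <= Num.max y 1).
rewrite !(extend_x1 _ (_ : 1 <= Num.max y 1)) ?le_max ?lexx ?orbT// => /(_ isT); lra.
Qed.

Lemma extend_incrr x y1 y2 : y1 <= y2 -> B x y2 - B x y1 <= clamp y2 - clamp y1.
Proof.
move=> y12; have := extend_volume_ge0 (_ : x <= Num.max x 1) y12.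
rewrite !(extend_1y _ (_ : 1 <= Num.max x 1)) ?le_max ?lexx ?orbT// => /(_ isT); lra.
Qed.

Lemma extend_lipl x1 x2 y : `|B x1 y - B x2 y| <= `|x1 - x2|.
Proof.
apply: le_trans (clamp_lip _ _).
wlog x12 : x1 x2 / x1 <= x2.
  by case: (leP x1 x2) => [xy /(_ _ _ xy)//|/ltW xy /(_ _ _ xy)]; rewrite distrC (distrC (clamp x2)).
rewrite distrC (distrC (clamp x1)) !ger0_norm ?subr_ge0 ?clamp_nd ?extend_ndl//.
exact: extend_incrl.
Qed.

Lemma extend_lipr x y1 y2 : `|B x y1 - B x y2| <= `|y1 - y2|.
Proof.
apply: le_trans (clamp_lip _ _).
wlog y12 : y1 y2 / y1 <= y2.
  by case: (leP y1 y2) => [xy /(_ _ _ xy)//|/ltW xy /(_ _ _ xy)]; rewrite distrC (distrC (clamp y2)).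
rewrite distrC (distrC (clamp y1)) !ger0_norm ?subr_ge0 ?clamp_nd ?extend_ndr//.
exact: extend_incrr.
Qed.

End extension.

(** * Existence of the measure of a copula *)

Section stieltjes.
Context {R : realType}.
Local Open Scope ereal_scope.

(** Both measures are infima of sums over the same covers by half-open intervals,
    so comparing increments is enough, even on non-measurable sets. *)
Lemma le_lebesgue_stieltjes_measure (F G : cumulative R R) :
  (forall a b, a <= b -> F b - F a <= G b - G a)%R ->
  forall E : set R, lebesgue_stieltjes_measure F E <= lebesgue_stieltjes_measure G E.
Proof.
move=> FG E; rewrite /lebesgue_stieltjes_measure /measure_extension /mu_ext.
apply: le_ereal_inf_tmp => _ [C [mC EC] <-].
apply: (@le_trans _ _ (\sum_(k <oo) wlength F (C k))).
  by apply: ereal_inf_lbound; exists C.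
apply: lee_nneseries => [k _ _|k _]; first exact: wlength_ge0.
have [/= [a b] _ <-] := mC k.
case: (leP a b) => ab; last by rewrite set_itv_ge ?wlength0// bnd_simp -leNgt ltW.
by rewrite !wlength_itv_bnd// lee_fin FG.
Qed.

Lemma lebesgue_stieltjes_measure_oc (F : cumulative R R) a b : (a <= b)%R ->
  lebesgue_stieltjes_measure F `]a, b]%classic = (F b - F a)%:E.
Proof.
move=> ab; rewrite /lebesgue_stieltjes_measure /measure_extension measurable_mu_extE/=.
  by rewrite wlength_itv_bnd.
exact: is_ocitv.
Qed.

End stieltjes.

Section marginals.
Context {R : realType}.
Variables (A : R -> R -> R) (cA : is_copula A).
Local Notation B := (extend A).

Lemma clamp_rc : right_continuous (clamp : R -> R).
Proof. by apply/right_continuousW => x; exact: continuous_clamp. Qed.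

Lemma clamp_Ny : (clamp x : R) @[x --> -oo] --> (0 : R).
Proof.
by apply: cvg_near_cst; near=> x; rewrite clamp_le0.
Unshelve. all: by end_near. Qed.

Lemma clamp_y : (clamp x : R) @[x --> +oo] --> (1 : R).
Proof.
by apply: cvg_near_cst; near=> x; rewrite clamp_ge1.
Unshelve. all: by end_near. Qed.

HB.instance Definition _ := isCumulative.Build R _ R clamp (@clamp_nd R) clamp_rc.
HB.instance Definition _ := isCumulativeBounded.Build R 0 1 clamp clamp_Ny clamp_y.

(** The uniform law on the unit interval, as the Stieltjes measure of its
    distribution function: in this form it is comparable with the slices below. *)
Definition unif01 : probability (measurableTypeR R) R :=
  lebesgue_stieltjes_measure (clamp : cumulativeBounded (0:R) (1:R)).

Lemma unif01_oc (a b : R) : a <= b -> unif01 `]a, b]%classic = (clamp b - clamp a)%:E.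
Proof. exact: lebesgue_stieltjes_measure_oc. Qed.

Lemma extend_rc y : right_continuous (B ^~ y).
Proof.
apply/right_continuousW => x; apply/cvgrPdist_lt => e e0; near=> z.
apply: le_lt_trans (extend_lipl cA _ _ _) _.
by near: z; apply: cvgr_dist_lt => //; exact: cvg_id.
Unshelve. all: by end_near. Qed.

Definition slice_cumulative y : cumulative R R :=
  HB.pack (B ^~ y) (isCumulative.Build R _ R (B ^~ y) (fun x1 x2 => extend_ndl cA y) (@extend_rc y)).

Definition slice_measure y := lebesgue_stieltjes_measure (slice_cumulative y).

End marginals.

Section density_le.
Context d (T : measurableType d) (R : realType).
Local Open Scope ereal_scope.

(** On the set where [g < f] the difference [f - g] is positive with nonpositive
    integral. *)
Lemma integral_le_negligible (mu : {measure set T -> \bar R}) (f g : T -> R) :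
  mu.-integrable setT (EFin \o f) -> mu.-integrable setT (EFin \o g) ->
  (forall E, measurable E -> \int[mu]_(x in E) (f x)%:E <= \int[mu]_(x in E) (g x)%:E) ->
  \forall x \ae mu, (f x <= g x)%R.
Proof.
move=> intf intg fg.
have mf : measurable_fun setT f by apply/measurable_EFinP; exact: measurable_int intf.
have mg : measurable_fun setT g by apply/measurable_EFinP; exact: measurable_int intg.
pose E := [set x | (g x < f x)%R].
have mE : measurable E.
  have := measurable_fun_ltr mg mf measurableT (_ : measurable [set true]).
  by rewrite setTI; apply.
have intfE : mu.-integrable E (EFin \o f) by exact: integrableS intf.
have intgE : mu.-integrable E (EFin \o g) by exact: integrableS intg.
have intE : \int[mu]_(x in E) `|(f x - g x)%:E| = 0.
  apply/eqP; rewrite eq_le integral_ge0// andbT.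
  rewrite (eq_integral (fun x => (f x)%:E - (g x)%:E)); last first.
    by move=> x; rewrite inE /E/= => gf; rewrite ger0_norm// subr_ge0 ltW.
  by rewrite integralB_EFin// sube_le0 fg.
have mfg : measurable_fun E (fun x => (f x - g x)%:E).
  by apply/measurable_EFinP/measurable_funTS; exact: measurable_funB.
have [N [mN N0 EN]] := (ae_eq_integral_abs mu mE mfg).1 intE.
exists N; split => // x /= /negP; rewrite -ltNge => gfx.
by apply: EN => /= /(_ gfx) /eqP; rewrite eqe subr_eq0 gt_eqF.
Qed.

End density_le.

Section disintegration.
Context {R : realType}.
Variables (A : R -> R -> R) (cA : is_copula A).
Local Notation B := (extend A).
Local Notation U := (@unif01 R).
Local Open Scope ereal_scope.

Lemma slice_measure_le_unif01 y E : slice_measure cA y E <= U E.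
Proof. by apply: le_lebesgue_stieltjes_measure => a b; exact: extend_incrl. Qed.

Lemma slice_measure_nd y1 y2 E : (y1 <= y2)%R -> slice_measure cA y1 E <= slice_measure cA y2 E.
Proof.
move=> y12; apply: le_lebesgue_stieltjes_measure => a b ab /=.
have := extend_volume_ge0 cA ab y12; lra.
Qed.

HB.instance Definition _ y := Measure.on (slice_measure cA y).

Lemma slice_measure_fin y : fin_num_fun (slice_measure cA y).
Proof.
move=> E mE; rewrite ge0_fin_numE// (le_lt_trans (slice_measure_le_unif01 y E))//.
by rewrite (le_lt_trans (probability_le1 _ _))// ltry.
Qed.

HB.instance Definition _ y := Measure_isFinite.Build _ _ _ (slice_measure cA y) (@slice_measure_fin y).

(** The density exists since the slice is dominated by the uniform law, and it is
    at most 1 almost everywhere for the same reason; clamping makes the bounds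
    hold everywhere. *)
Lemma slice_density y : exists f : measurableTypeR R -> R,
  [/\ measurable_fun setT f, forall x, (0 <= f x <= 1)%R &
      forall E, measurable E -> \int[U]_(x in E) (f x)%:E = slice_measure cA y E].
Proof.
have dom : slice_measure cA y `<< U.
  apply/null_content_dominatesP => E mE UE0.
  by apply/eqP; rewrite eq_le measure_ge0 -UE0 slice_measure_le_unif01.
have [f [f0 ffin intf fE]] := radon_nikodym_sigma_finite dom.
have fEq : EFin \o (fine \o f) = f by apply/funext => x /=; rewrite fineK.
have mf : measurable_fun setT (fine \o f).
  by apply/measurable_EFinP; rewrite fEq; exact: measurable_int intf.
have mcf : measurable_fun setT (clamp \o (fine \o f)).
  by apply: measurableT_comp => //; apply: continuous_measurable_fun; exact: continuous_clamp.
exists (clamp \o (fine \o f)); split => //.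
- by move=> x; rewrite /= clamp_ge0 clamp_le1.
- move=> E mE; rewrite fE//; apply: ae_eq_integral => //.
  + by apply/measurable_EFinP; exact: measurable_funS mcf.
  + exact: measurable_funS (measurable_int _ intf).
  + have : \forall x \ae U, ((fine \o f) x <= 1)%R.
      apply: integral_le_negligible.
      * by rewrite fEq.
      * exact: finite_measure_integrable_cst.
      * move=> D mD; rewrite integral_cst// mul1e (le_trans _ (slice_measure_le_unif01 y D))//.
        by rewrite fE//; under eq_integral do rewrite fineK//.
    apply: filterS => x fx1 _ /=.
    by rewrite clamp_id// ?fineK//; exact: fine_ge0.
Qed.

(** A version of the conditional probability that the second coordinate is at
    most [y], given the first one. *)
Definition cond_cdf y : measurableTypeR R -> R := sval (cid (slice_density y)).

Lemma measurable_cond_cdf y : measurable_fun setT (cond_cdf y).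
Proof. by rewrite /cond_cdf; case: cid => f []. Qed.

Lemma cond_cdf_itv y x : (0 <= cond_cdf y x <= 1)%R.
Proof. by rewrite /cond_cdf; case: cid => f []. Qed.

Lemma integral_cond_cdf y E : measurable E ->
  \int[U]_(x in E) (cond_cdf y x)%:E = slice_measure cA y E.
Proof. by move=> mE; have [_ _] := svalP (cid (slice_density y)); apply. Qed.

Lemma integrable_cond_cdf y : U.-integrable setT (EFin \o cond_cdf y).
Proof.
apply: measurable_bounded_integrable => //.
- by rewrite (le_lt_trans (probability_le1 _ _))// ltry.
- exact: measurable_cond_cdf.
- exists 1%R; split => // M M1 x _ /=.
  have /andP[f0 f1] := cond_cdf_itv y x.
  by rewrite ger0_norm// (le_trans f1)// ltW.
Qed.

(** Monotonicity in [y] only holds almost everywhere, with an exceptional set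
    depending on the two ordinates; this is why the quantile below only looks at
    countably many ordinates. *)
Lemma cond_cdf_nd y1 y2 : (y1 <= y2)%R ->
  \forall x \ae U, (cond_cdf y1 x <= cond_cdf y2 x)%R.
Proof.
move=> y12; apply: integral_le_negligible; [exact: integrable_cond_cdf..|].
by move=> E mE; rewrite !integral_cond_cdf// slice_measure_nd.
Qed.

End disintegration.

Section support.
Context d (T : measurableType d) (R : realType).
Local Open Scope ereal_scope.

Lemma probability_setI_full (P : probability T R) (S E : set T) :
  measurable S -> measurable E -> P S = 1 -> P (E `&` S) = P E.
Proof.
move=> mS mE PS; rewrite [RHS](measureDI _ mE mS) [X in _ = X + _](_ : _ = 0) ?add0e//.
apply/eqP; rewrite eq_le measure_ge0 andbT.
have PCS : P (~` S) = 0 by rewrite probability_setC// PS subee.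
by rewrite -PCS le_measure ?inE//; [exact: measurableD|exact: measurableC].
Qed.

End support.

Section existence.
Context {R : realType}.
Variables (A : R -> R -> R) (cA : is_copula A).
Local Notation B := (extend A).
Local Notation U := (@unif01 R).
Local Notation V := (U \x U)%E.
Local Notation cdf := (cond_cdf cA).
Local Open Scope ereal_scope.

Lemma unif01_Ny c : (0 <= c <= 1)%R -> U `]-oo, c]%classic = c%:E.
Proof.
move=> /andP[c0 c1].
have N1 : U `](-1)%R, 1%R]%classic = 1.
  by rewrite unif01_oc ?(@clamp_ge1 _ 1) ?(@clamp_le0 _ (-1)) ?subr0 ?lerN10//; lra.
rewrite -(probability_setI_full _ _ N1)// (_ : _ `&` _ = `](-1)%R, c]%classic).
  by rewrite unif01_oc ?(clamp_id c0 c1) ?(@clamp_le0 _ (-1)) ?subr0 ?lerN10//; lra.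
apply/seteqP; split => x /=; rewrite !in_itv/=; first by move=> [xc /andP[x1 _]]; rewrite x1 xc.
by move=> /andP[x1 xc]; split => //; rewrite x1/=; lra.
Qed.

Definition subgraph y : set (planeT R) := [set p | (p.2 <= cdf y p.1)%R].

Lemma measurable_subgraph y : measurable (subgraph y).
Proof.
have := @measurable_fun_ler _ _ _ setT (snd : planeT R -> R) (fun p => cdf y p.1) measurable_snd.
move=> /(_ (measurableT_comp (@measurable_cond_cdf _ _ cA y) measurable_fst)).
by move=> /(_ measurableT [set true] I); rewrite setTI.
Qed.

Lemma subgraph_measure y E : measurable E ->
  V ((E `*` setT) `&` subgraph y) = slice_measure cA y E.
Proof.
move=> mE; rewrite -integral_cond_cdf// /product_measure1 [RHS]integral_mkcond.
apply: eq_integral => x _ /=; rewrite patchE; case: ifPn => xE.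
  rewrite -[RHS](@unif01_Ny (cdf y x)); last exact: cond_cdf_itv.
  congr (U _); apply/seteqP; split => v; rewrite /xsection /= inE /= in_itv/=.
    by case.
  by move=> vc; split => //; split => //; rewrite inE in xE.
rewrite -[RHS](measure0 U); congr (U _); apply/seteqP; split => v //.
by rewrite /xsection /= inE /= => -[[xE' _] _]; move: xE; rewrite notin_setE.
Qed.

Local Close Scope ereal_scope.

(** Its values are dense in the nonnegative reals. *)
Definition dense_seq n : R := if unpickle n is Some r then Num.max 0%R (ratr (r : rat)) else 1%R.

Lemma dense_seq_ge0 n : (0 <= dense_seq n)%R.
Proof. by rewrite /dense_seq; case: unpickle => [r|//]; rewrite le_max lexx. Qed.

Lemma dense_seq_ex (a b : R) : (a < b)%R -> (0 < b)%R -> exists n, (a < dense_seq n < b)%R.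
Proof.
move=> ab b0; have ab' : (Num.max 0 a < b)%R by rewrite gt_max b0.
have [r] := rat_in_itvoo ab'; rewrite in_itv/= gt_max => /andP[/andP[r0 ra] rb].
by exists (pickle r); rewrite /dense_seq pickleK max_r ?ra ?rb// ltW.
Qed.

(** The infimum of these values over [n] is the conditional quantile of level
    [p.2] at the abscissa [p.1], capped at 1. *)
Definition quantile_at n (p : planeT R) : R :=
  if (p.2 <= cdf (dense_seq n) p.1)%R then Num.min 1%R (dense_seq n) else 1%R.

Definition quantile (p : planeT R) : R := infs (quantile_at ^~ p) 0.

Lemma quantile_at_ge0 n p : (0 <= quantile_at n p)%R.
Proof. by rewrite /quantile_at; case: ifP => // _; rewrite le_min ler01 dense_seq_ge0. Qed.

Lemma quantile_at_le1 n p : (quantile_at n p <= 1)%R.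
Proof. by rewrite /quantile_at; case: ifP => // _; rewrite ge_min lexx. Qed.

Lemma quantile_has_lbound p : has_lbound (range (quantile_at ^~ p)).
Proof. by exists 0%R => _ [n _ <-]; exact: quantile_at_ge0. Qed.

Lemma quantile_le n p : (quantile p <= quantile_at n p)%R.
Proof.
apply: ge_inf; last by exists n.
by exists 0%R => _ [m _ <-]; exact: quantile_at_ge0.
Qed.

Lemma quantile_ge0 p : (0 <= quantile p)%R.
Proof.
apply: lb_le_inf; first by exists (quantile_at 0 p); exists 0%N.
by move=> _ [n _ <-]; exact: quantile_at_ge0.
Qed.

Lemma quantile_le1 p : (quantile p <= 1)%R.
Proof. exact: le_trans (quantile_le 0 p) (quantile_at_le1 0 p). Qed.

Lemma quantile_lt p b : (b <= 1)%R ->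
  (quantile p < b)%R <-> exists2 n, (dense_seq n < b)%R & subgraph (dense_seq n) p.
Proof.
move=> b1; split=> [/inf_lt|[n nb np]].
  move=> [|_ [n _ <-]]; first by exists (quantile_at 0 p); exists 0%N.
  rewrite /quantile_at; case: ifPn => [pn|_]; last by rewrite ltNge b1.
  by rewrite gt_min ltNge b1/= => nb; exists n.
apply: le_lt_trans (quantile_le n p) _.
by rewrite /quantile_at ifT// gt_min nb orbT.
Qed.

Lemma measurable_quantile : measurable_fun setT quantile.
Proof.
apply: measurable_fun_infs; first by move=> p _; exact: quantile_has_lbound.
move=> n; apply: measurable_fun_ifT => //.
apply: (@measurable_fun_ler _ _ _ setT (snd : planeT R -> R)) => //.
by apply: (measurableT_comp (@measurable_cond_cdf _ _ cA _)).
Qed.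

Lemma slice_measure_oc a y : (0 <= a)%R ->
  slice_measure cA y `](-1)%R, a]%classic = (B a y)%:E.
Proof.
move=> a0; rewrite [LHS]lebesgue_stieltjes_measure_oc/=; last lra.
by rewrite (@extend_0y _ _ cA (-1)) ?subr0//; lra.
Qed.

End existence.

Section existence.
Context {R : realType}.
Variables (A : R -> R -> R) (cA : is_copula A).
Local Notation B := (extend A).
Local Notation U := (@unif01 R).
Local Notation V := (U \x U)%E.
Local Notation Y := (quantile cA).
Local Notation cdf := (cond_cdf cA).

Lemma measurable_strip E : measurable E ->
  measurable (E `*` setT : set (planeT R)).
Proof. by move=> mE; apply: measurableX. Qed.

Lemma strip_measure E : measurable E -> V (E `*` setT) = U E.
Proof.
move=> mE; transitivity (U E * U setT)%E; first exact: product_measure1E.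
by rewrite probability_setT mule1.
Qed.

(** The event is the union of the subgraphs over the [dense_seq n < b].  Each of
    them is contained, outside a strip over a common null set, in the subgraph
    at [b], and those with [dense_seq n] close to [b] have almost the measure
    [B a b] by continuity. *)
Lemma quantile_law a b : 0 <= a -> 0 < b -> b <= 1 ->
  V ((`]-1, a]%classic `*` setT) `&` [set p | Y p < b]) = (B a b)%:E.
Proof.
move=> a0 b0 b1.
pose E : set (measurableTypeR R) := `]-1, a]%classic.
have mE : measurable E by exact: measurable_itv.
have mYb : measurable [set p | Y p < b].
  have := @measurable_quantile _ _ cA measurableT `]-oo, b[%classic (measurable_itv _).
  by rewrite setTI; congr measurable; apply/seteqP; split => p /=; rewrite in_itv.
have mEY := measurableI _ _ (measurable_strip mE) mYb.
apply/eqP; rewrite eq_le; apply/andP; split.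
  (* A single null set [N] works for all the ordinates of the sequence. *)
  have /ae_foralln : forall n, \forall x \ae U, @dense_seq R n < b -> cdf (@dense_seq R n) x <= cdf b x.
    move=> n; have [nb|nb] := ltP (@dense_seq R n) b; last by apply: aeW => x.
    by have := cond_cdf_nd cA (ltW nb); apply: filterS.
  move=> [N [mN N0 subN]].
  rewrite -(slice_measure_oc cA b a0) -subgraph_measure//.
  apply: (@le_trans _ _ (V (((E `*` setT) `&` subgraph cA b) `|` (N `*` setT)))).
    apply: le_measure; rewrite ?inE//.
      apply: measurableU; last exact: measurable_strip.
      by apply: measurableI; [exact: measurable_strip|exact: measurable_subgraph].
    move=> [x v] [Exv] /= /(quantile_lt _ _ b1)[n nb /= xv].
    have [xN|xN] := pselect (N x); [by right|left; split => //].
    have /contrapT/(_ n nb) := contra_not (subN x) xN.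
    exact: le_trans.
  apply: le_trans (measureU2 _ _ _) _; last 1 first.
  - by rewrite [X in (_ + X <= _)%E]strip_measure// N0 adde0.
  - by apply: measurableI; [exact: measurable_strip|exact: measurable_subgraph].
  - exact: measurable_strip.
apply/lee_addgt0Pr => e e0.
have [|n /andP[ben nb]] := @dense_seq_ex R (b - e) b _ b0; first lra.
apply: (@le_trans _ _ (B a (@dense_seq R n) + e)%:E).
  rewrite lee_fin; have := extend_incrr cA a (ltW nb); have := clamp_lip b (@dense_seq R n).
  rewrite ger0_norm ?subr_ge0 ?clamp_nd ?(ltW nb)// ger0_norm ?subr_ge0 ?(ltW nb)//; lra.
rewrite EFinD leeD2r// -(slice_measure_oc cA _ a0) -subgraph_measure//.
apply: le_measure; rewrite ?inE//.
  by apply: measurableI; [exact: measurable_strip|exact: measurable_subgraph].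
move=> p [Ep pn]; split => //=.
by apply/quantile_lt => //; exists n.
Qed.

Definition quantile_pair (p : planeT R) : planeT R := (p.1, Y p).

Lemma measurable_quantile_pair : measurable_fun setT quantile_pair.
Proof. by apply: measurable_fun_pair => //; exact: measurable_quantile. Qed.

HB.instance Definition _ :=
  isMeasurableFun.Build _ _ _ _ quantile_pair measurable_quantile_pair.

(** Passing from the strict to the large inequality is harmless because [B a] is
    continuous. *)
Lemma quantile_law_le a b : 0 <= a -> a <= 1 -> 0 <= b -> b <= 1 ->
  V ((`]-1, a]%classic `*` setT) `&` [set p | Y p <= b]) = (B a b)%:E.
Proof.
move=> a0 a1 b0 b1.
have mE : measurable (`]-1, a]%classic : set (measurableTypeR R)) by exact: measurable_itv.
have mY c : measurable ((`]-1, a]%classic `*` setT) `&` [set p | Y p < c] : set (planeT R)).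
  apply: measurableI; first exact: measurable_strip.
  have := @measurable_quantile _ _ cA measurableT `]-oo, c[%classic (measurable_itv _).
  by rewrite setTI; congr measurable; apply/seteqP; split => p /=; rewrite in_itv.
have mYle : measurable ((`]-1, a]%classic `*` setT) `&` [set p | Y p <= b] : set (planeT R)).
  apply: measurableI; first exact: measurable_strip.
  have := @measurable_quantile _ _ cA measurableT `]-oo, b]%classic (measurable_itv _).
  by rewrite setTI; congr measurable; apply/seteqP; split => p /=; rewrite in_itv.
have [b1'|] := ltP b 1; last first.
  move=> b1'; have -> : b = 1 by apply/eqP; rewrite eq_le b1.
  rewrite (_ : _ `&` _ = `]-1, a]%classic `*` setT); last first.
    by rewrite (_ : [set p | Y p <= 1] = setT) ?setIT//; apply/seteqP; split => // p _; exact: quantile_le1.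
  rewrite strip_measure// unif01_oc; last lra.
  by rewrite (@clamp_le0 _ (-1)) ?lerN10// extend_x1// subr0.
apply/eqP; rewrite eq_le; apply/andP; split.
  apply/lee_addgt0Pr => e e0.
  have [c [bc ce c1]] : exists c, [/\ b < c, c <= b + e & c <= 1].
    case: (leP (b + e) 1) => [be1|be1]; first by exists (b + e); split => //; lra.
    by exists 1; split => //; exact: ltW.
  apply: (@le_trans _ _ (B a c)%:E).
    rewrite -quantile_law ?(le_lt_trans b0)//; apply: le_measure; rewrite ?inE//.
    by move=> p [Ep /= Yb]; split => //=; exact: le_lt_trans bc.
  rewrite lee_fin; have := extend_incrr cA a (ltW bc); have := clamp_lip c b.
  rewrite ger0_norm ?subr_ge0 ?clamp_nd ?(ltW bc)// ger0_norm ?subr_ge0 ?(ltW bc)//; lra.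
have [b0'|] := ltP 0 b; last by move=> ?; rewrite extend_x0.
rewrite -quantile_law//; apply: le_measure; rewrite ?inE//.
by move=> p [Ep /= Yb]; split => //=; exact: ltW.
Qed.

Lemma copula_measure_ex : exists mu : probability (planeT R) R, is_copula_measure A mu.
Proof.
exists (distribution V quantile_pair).
move=> a b a01 b01; rewrite -(extendE A a01 b01) /distribution /pushforward /=.
move: a01 b01; rewrite /unit_interval /= !in_itv /= => /andP[a0 a1] /andP[b0 b1].
rewrite -quantile_law_le//.
(* The two events agree on this strip of full measure; it removes the abscissas
   that are at most 0, which the half-open interval starting at -1 contains. *)
pose S : set (planeT R) := `]0, 1]%classic `*` setT.
have mS : measurable S by apply: measurable_strip; exact: measurable_itv.
have VS : V S = 1%E.
  rewrite strip_measure ?unif01_oc//.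
  by rewrite clamp_ge1// clamp_le0// subr0.
rewrite -[LHS](probability_setI_full mS _ VS); last first.
  rewrite -[X in measurable X]setTI; apply: measurable_quantile_pair => //.
  by apply: measurableX; exact: measurable_itv.
rewrite -[RHS](probability_setI_full mS _ VS); last first.
  apply: measurableI; first by apply: measurable_strip; exact: measurable_itv.
  have := @measurable_quantile _ _ cA measurableT `]-oo, b]%classic (measurable_itv _).
  by rewrite setTI; congr measurable; apply/seteqP; split => p /=; rewrite in_itv.
congr (V _); apply/seteqP; split => -[x v] /=; rewrite /quantile_pair /S/= !in_itv/=.
  move=> [[/andP[x0 xa] /andP[_ yb]] Sxv].
  by split => //; split => //; split => //; rewrite xa andbT; lra.
move=> [[[/andP[_ xa] _] yb] Sxv].
split => //; have [/= + _] := Sxv; move=> /andP[/ltW x0 _].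
by split; apply/andP; split => //; exact: quantile_ge0.
Qed.

End existence.

(** * Riemann sums against a copula measure *)

Lemma probability_setD d (T : measurableType d) (R : realType) (P : probability T R)
    (E F : set T) : measurable E -> measurable F -> F `<=` E ->
  P (E `\` F) = (P E - P F)%E.
Proof.
move=> mE mF FE; rewrite -[in RHS](setIidr FE); apply: measureD => //.
by rewrite (le_lt_trans (probability_le1 _ _))// ltry.
Qed.

Section copula_measure_boxes.
Context {R : realType}.
Variables (A : R -> R -> R) (cA : is_copula A).
Variables (mu : probability (planeT R) R) (muA : is_copula_measure A mu).
Local Notation B := (extend A).

Lemma measurable_box (I J : interval R) :
  measurable ([set` I] `*` [set` J] : set (planeT R)).
Proof. by apply: measurableX; exact: measurable_itv. Qed.

Lemma measurable_unit_square : measurable (unit_square R : set (planeT R)).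
Proof. exact: measurable_box. Qed.

Lemma copula_measure_square : mu (unit_square R) = 1%E.
Proof.
have u1 : unit_interval R (1 : R) by rewrite /unit_interval /= in_itv /= lexx ler01.
by rewrite [LHS](muA u1 u1) (copula_x1 cA).
Qed.

Lemma copula_measure_quadrant x y :
  mu (`]-oo, x]%classic `*` `]-oo, y]%classic) = (B x y)%:E.
Proof.
have := probability_setI_full measurable_unit_square
  (measurable_box `]-oo, x] `]-oo, y]) copula_measure_square.
move=> <-; case: (ltP x 0) => x0.
  rewrite (extend_0y cA); last exact: ltW.
  rewrite (_ : _ `&` _ = set0) ?measure0//.
  apply/seteqP; split => // -[a b] [[/= + _] [/= + _]].
  by rewrite /unit_interval /= !in_itv/= => ax /andP[a0 _]; lra.
case: (ltP y 0) => y0.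
  rewrite (extend_x0 cA); last exact: ltW.
  rewrite (_ : _ `&` _ = set0) ?measure0//.
  apply/seteqP; split => // -[a b] [[/= _ +] [/= _ +]].
  by rewrite /unit_interval /= !in_itv/= => ax /andP[a0 _]; lra.
rewrite /extend -muA; [|exact: clamp_itv|exact: clamp_itv].
congr (mu _); apply/seteqP; split => -[a b] /=;
  rewrite /unit_square /unit_interval /= !in_itv/=.
  move=> [[ax yb] [/andP[a0 a1] /andP[b0 b1]]].
  by rewrite a0 b0/=; split;
    [case: (clampP x) => [[]|[]|[]]|case: (clampP y) => [[]|[]|[]]] => *; lra.
have := clamp_le1 x; have := clamp_le1 y.
move=> y1 x1 [/andP[-> ax] /andP[-> yb]]; split; split => /=; try lra.
  by case: (clampP x) => [[]|[]|[]] => *; lra.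
by case: (clampP y) => [[]|[]|[]] => *; lra.
Qed.

Lemma copula_measure_box x1 x2 y1 y2 : x1 <= x2 -> y1 <= y2 ->
  mu (`]x1, x2]%classic `*` `]y1, y2]%classic) =
  (B x2 y2 - B x1 y2 - B x2 y1 + B x1 y1)%:E.
Proof.
move=> x12 y12.
have strip y : mu (`]x1, x2]%classic `*` `]-oo, y]%classic) = (B x2 y - B x1 y)%:E.
  rewrite (_ : _ `*` _ = (`]-oo, x2]%classic `*` `]-oo, y]%classic) `\`
    (`]-oo, x1]%classic `*` `]-oo, y]%classic)); last first.
    apply/seteqP; split => -[a b] /=; rewrite !in_itv/=.
      move=> [/andP[xa ax] yb]; split => // -[]; lra.
    move=> [[ax yb] /not_andP[/negP|//]]; rewrite -ltNge => xa.
    by rewrite xa.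
  rewrite probability_setD ?copula_measure_quadrant//; try exact: measurable_box.
  by move=> [a b] /=; rewrite !in_itv/= => -[ax yb]; split => //; exact: le_trans x12.
rewrite (_ : _ `*` _ = (`]x1, x2]%classic `*` `]-oo, y2]%classic) `\`
    (`]x1, x2]%classic `*` `]-oo, y1]%classic)); last first.
  apply/seteqP; split => -[a b] /=; rewrite !in_itv/=.
    move=> [xa /andP[yb bY]]; split => // -[]; lra.
  move=> [[ax yb] /not_andP[//|/negP]]; rewrite -ltNge => xa.
  by rewrite xa.
rewrite probability_setD; try exact: measurable_box.
  by rewrite !strip -EFinB; congr EFin; lra.
by move=> [a b] /=; rewrite !in_itv/= => -[ax yb]; split => //; exact: le_trans y12.
Qed.

End copula_measure_boxes.

Section grid.
Context {R : realType}.
Variable n : nat.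
Local Notation idx := ('I_n.+2 * 'I_n.+2)%type.
Local Notation d := (n.+1%:R^-1 : R).

Definition node (i : 'I_n.+2) : R := i%:R * d.

(** The cell ending at the node 0 meets the unit interval in 0 only.  With
    it the cells cover the unit interval disjointly, and its boxes get volume 0
    from [extend]. *)
Definition cell (i : 'I_n.+2) : interval R := `]node i - d, node i].

Definition box (ij : idx) : set (planeT R) := [set` cell ij.1] `*` [set` cell ij.2].

Lemma mesh_gt0 : 0 < d. Proof. by rewrite invr_gt0 ltr0n. Qed.

Lemma node_itv i : unit_interval R (node i).
Proof.
rewrite /unit_interval /= in_itv /= /node mulr_ge0// ?(ltW mesh_gt0)//=.
by rewrite ler_pdivrMr ?ltr0n// mul1r ler_nat -ltnS.
Qed.

Lemma cell_ex x : unit_interval R x -> exists i, x \in cell i.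
Proof.
rewrite /unit_interval /= in_itv /= => /andP[x0 x1].
have ex : exists k, x <= k%:R * d.
  by exists n.+1; rewrite mulfV// pnatr_eq0.
pose k := ex_minn ex.
have [xk kmin] : x <= k%:R * d /\ forall m, x <= m%:R * d -> (k <= m)%N.
  by rewrite /k; case: ex_minnP.
have kn : (k < n.+2)%N by rewrite ltnS; apply: kmin; rewrite mulfV// pnatr_eq0.
exists (Ordinal kn); rewrite in_itv/= /node/= xk andbT.
case: k {kn} xk kmin => [_ _|k _ kmin]; first by rewrite mul0r sub0r (lt_le_trans _ x0)// oppr_lt0 mesh_gt0.
rewrite ltNge; apply/negP => xk; suff : (k < k)%N by rewrite ltnn.
by apply: kmin; rewrite -[k.+1]addn1 natrD mulrDl mul1r addrK in xk.
Qed.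

Lemma cell_uniq x i j : x \in cell i -> x \in cell j -> i = j.
Proof.
wlog : i j / (i <= j)%N.
  by move=> H xi xj; have [/H|/ltnW/H ->] := leqP i j; [exact|..].
rewrite leq_eqVlt => /predU1P[/val_inj//|ij].
rewrite !in_itv/= => /andP[_ xi] /andP[xj _].
suff ij' : node i <= node j - d; first by have := lt_le_trans xj (le_trans xi ij'); rewrite ltxx.
rewrite /node -[X in _ - X]mul1r -mulrBl ler_wpM2r ?(ltW mesh_gt0)//.
by rewrite lerBrDr natr1 ler_nat.
Qed.

Definition step_fun (h : planeT R -> R) (p : planeT R) : R :=
  \sum_(ij : idx) h (node ij.1, node ij.2) * \1_(box ij) p.

Lemma step_funE h p ij : box ij p -> step_fun h p = h (node ij.1, node ij.2).
Proof.
case: ij => i j [/= pi pj]; rewrite /step_fun (bigD1 (i, j))//= indicE mem_set// mulr1 big1 ?addr0//.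
move=> [k l] /= klij; rewrite indicE memNset ?mulr0// => -[/= pk pl]; move: klij.
by rewrite (cell_uniq pk pi) (cell_uniq pl pj) eqxx.
Qed.

(** Both integrands [A x y] and [x * y] have this property, from which their
    Riemann sums converge at a rate independent of the copula. *)
Definition square_lipschitz (h : planeT R -> R) := forall p q : planeT R,
  unit_square R p -> unit_square R q ->
  `|h p - h q| <= `|p.1 - q.1| + `|p.2 - q.2|.

Lemma step_fun_approx h p : square_lipschitz h -> unit_square R p ->
  `|h p - step_fun h p| <= 2 * d.
Proof.
have aux (x y e : R) : y - e < x -> x <= y -> `|x - y| <= e.
  by move=> ? ?; rewrite ler0_norm; lra.
move=> lh Sp; have [/cell_ex[i pi] /cell_ex[j pj]] := Sp.
rewrite (@step_funE h p (i, j))//=.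
apply: le_trans (lh _ _ Sp _) _; first by split; exact: node_itv.
rewrite mulr2n mulrDl mul1r; apply: lerD => /=.
  by move: pi; rewrite in_itv/= => /andP[? ?]; exact: aux.
by move: pj; rewrite in_itv/= => /andP[? ?]; exact: aux.
Qed.

Lemma measurable_box_idx ij : measurable (box ij).
Proof. exact: measurable_box. Qed.

Lemma measurable_step_fun h D : measurable_fun D (step_fun h).
Proof.
apply: measurable_sum => ij; apply: measurable_funM => //.
by apply: measurable_indic; exact: measurable_box_idx.
Qed.

Definition box_volume (B : R -> R -> R) (ij : idx) : R :=
  let x := node ij.1 in let y := node ij.2 in
  B x y - B (x - d) y - B x (y - d) + B (x - d) (y - d).

Definition riemann_sum (h : planeT R -> R) (A : R -> R -> R) : R :=
  \sum_(ij : idx) h (node ij.1, node ij.2) * box_volume (extend A) ij.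

End grid.

Section lipschitz_integral.
Context {R : realType}.
Local Notation S := (unit_square R : set (planeT R)).
Implicit Types h : planeT R -> R.

(** Such a function is the pointwise limit of its step functions. *)
Lemma square_lipschitz_measurable h : square_lipschitz h -> measurable_fun S h.
Proof.
move=> lh; apply: (@measurable_fun_cvg _ _ _ S (fun n => step_fun n h)).
  by move=> n; exact: measurable_step_fun.
move=> p Sp; apply/cvgrPdist_le => e e0; have e2 : 0 < e / 2 by lra.
near=> n; apply: le_trans (step_fun_approx n lh Sp) _.
have : n.+1%:R^-1 < e / 2 by near: n; exact: near_infty_natSinv_lt (PosNum e2).
by move=> /ltW; rewrite ler_pdivlMr// mulrC.
Unshelve. all: by end_near. Qed.

Lemma bounded_square_integrable (mu : probability (planeT R) R) h M :
  measurable_fun S h -> (forall p, S p -> `|h p| <= M) ->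
  mu.-integrable S (EFin \o h).
Proof.
move=> mh hM; apply: measurable_bounded_integrable => //.
- exact: measurable_unit_square.
- rewrite (le_lt_trans (probability_le1 _ _)) ?ltry//; exact: measurable_unit_square.
- by exists M; split => [|N MN p Sp]; [exact: num_real|exact: le_trans (hM _ Sp) (ltW MN)].
Qed.

Lemma square_lipschitz_integrable (mu : probability (planeT R) R) h :
  square_lipschitz h -> mu.-integrable S (EFin \o h).
Proof.
move=> lh; apply: (@bounded_square_integrable _ _ (`|h (0, 0)| + 2)).
  exact: square_lipschitz_measurable.
move=> p Sp; have S0 : S (0, 0).
  by split; rewrite /unit_interval /= in_itv /= lexx ler01.
have aux (x : R) : unit_interval R x -> `|x - 0| <= 1.
  by rewrite /unit_interval /= in_itv /= subr0 => /andP[? ?]; rewrite ger0_norm.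
have := lh _ _ Sp S0; have := aux _ Sp.1; have := aux _ Sp.2 => /= h2 h1 hp.
have := lerB_dist (h p) (h (0, 0)).
by move: hp h1 h2; set u := `|h p - _|; set v := `|p.1 - 0|; set w := `|p.2 - 0|; lra.
Qed.

Section riemann.
Variables (A : R -> R -> R) (cA : is_copula A).
Variables (mu : probability (planeT R) R) (muA : is_copula_measure A mu).

Lemma integrable_step_fun n h : mu.-integrable S (EFin \o step_fun n h).
Proof.
apply: (@bounded_square_integrable _ _
  (\sum_(ij : 'I_n.+2 * 'I_n.+2) `|h (node ij.1, node ij.2)|)).
  exact: measurable_step_fun.
move=> p _.
apply: le_trans (ler_norm_sum _ _ _) _; apply: ler_sum => ij _.
by rewrite normrM ler_piMr// indicE; case: (_ \in _); rewrite ?normr1 ?normr0.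
Qed.

Lemma integral_step_fun n h : \int[mu]_(p in S) step_fun n h p = riemann_sum n h A.
Proof.
have intbox ij : mu.-integrable S (EFin \o (fun p => h (node ij.1, node ij.2) * \1_(@box R n ij) p)).
  have -> : EFin \o (fun p => h (node ij.1, node ij.2) * \1_(@box R n ij) p) =
    (fun p => (h (node ij.1, node ij.2))%:E * (\1_(box ij) p)%:E)%E by [].
  apply: integrableZl; first exact: measurable_unit_square.
  apply: (integrableS measurableT) => //; first exact: measurable_unit_square.
  by apply: integrable_indic; exact: measurable_box_idx.
rewrite /Rintegral /step_fun.
under eq_integral do rewrite -sumEFin.
rewrite integral_sum//; last exact: measurable_unit_square.
rewrite /riemann_sum.
have Eij (ij : 'I_n.+2 * 'I_n.+2) : (\int[mu]_(x in S) (h (node ij.1, node ij.2) * \1_(@box R n ij) x)%:E =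
    (h (node ij.1, node ij.2) * box_volume (extend A) ij)%:E)%E.
  under eq_integral do rewrite EFinM.
  rewrite integralZl//; last 2 first.
  - exact: measurable_unit_square.
  - apply: (integrableS measurableT) => //; first exact: measurable_unit_square.
    by apply: integrable_indic; exact: measurable_box_idx.
  rewrite integral_indic//; [|exact: measurable_unit_square|exact: measurable_box_idx].
  rewrite EFinM; congr (_ * _)%E.
  rewrite [LHS](probability_setI_full _ _ (copula_measure_square cA muA)); last 2 first.
  - exact: measurable_unit_square.
  - exact: measurable_box_idx.
  by rewrite /box (copula_measure_box cA muA)// gerBl ltW// mesh_gt0.
by under eq_bigr do rewrite Eij; rewrite sumEFin.
Qed.

(** The estimate is uniform in [h], [A] and [mu], which gives at once continuity
    in [A] and independence of [mu]. *)
Lemma riemann_approx n h : square_lipschitz h ->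
  `|\int[mu]_(p in S) h p - riemann_sum n h A| <= 2 * n.+1%:R^-1.
Proof.
move=> lh; rewrite -integral_step_fun -RintegralB//; last 3 first.
- exact: measurable_unit_square.
- exact: square_lipschitz_integrable.
- exact: integrable_step_fun.
have intB : mu.-integrable S (EFin \o (fun p => h p - step_fun n h p)).
  apply: (@bounded_square_integrable _ _ (2 * n.+1%:R^-1)).
    by apply: measurable_funB; [exact: square_lipschitz_measurable|exact: measurable_step_fun].
  by move=> p Sp; exact: step_fun_approx.
apply: le_trans (le_normr_Rintegral _ intB) _; first exact: measurable_unit_square.
apply: le_trans (_ : \int[mu]_(p in S) (2 * n.+1%:R^-1) <= _).
  apply: le_Rintegral.
  - exact: measurable_unit_square.
  - have := integrable_norm intB; apply: eq_integrable => //.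
    exact: measurable_unit_square.
  - by apply: finite_measure_integrable_cst; exact: measurable_unit_square.
  - by move=> p Sp; exact: step_fun_approx.
rewrite Rintegral_cst; last exact: measurable_unit_square.
by rewrite [X in fine X](copula_measure_square cA muA)/= mulr1.
Qed.

End riemann.
End lipschitz_integral.

(** * Compactness of the region *)

Section concordance_integrals.
Context {R : realType}.
Local Notation S := (unit_square R : set (planeT R)).

Lemma copula_measureP (A : R -> R -> R) : is_copula A -> is_copula_measure A (copula_measure A).
Proof. by move=> cA; have [mu muA] := copula_measure_ex cA; exact: (xgetPex _ (ex_intro _ mu muA)). Qed.

Lemma copula_square_lipschitz (A : R -> R -> R) : is_copula A ->
  square_lipschitz (fun p : planeT R => A p.1 p.2).
Proof.
move=> cA p q [p1 p2] [q1 q2] /=.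
rewrite -(extendE A p1 p2) -(extendE A q1 q2).
apply: le_trans (ler_distD (extend A q.1 p.2) _ _) _.
by apply: lerD; [exact: extend_lipl|exact: extend_lipr].
Qed.

Lemma mul_square_lipschitz : square_lipschitz (fun p : planeT R => p.1 * p.2).
Proof.
have aux (a b c d : R) : unit_interval R b -> unit_interval R c ->
    `|a * b - c * d| <= `|a - c| + `|b - d|.
  rewrite /unit_interval /= !in_itv/= => /andP[b0 b1] /andP[c0 c1].
  rewrite (_ : a * b - c * d = (a - c) * b + c * (b - d)); last by rewrite mulrBl mulrBr subrKA.
  apply: le_trans (ler_normD _ _) _; rewrite !normrM (ger0_norm b0) (ger0_norm c0).
  by apply: lerD; [rewrite ler_piMr|rewrite ler_piMl].
by move=> p q [p1 p2] [q1 q2]; exact: aux.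
Qed.

(** Both integrals are limits of the same Riemann sums, in which the measure does
    not occur. *)
Lemma square_lipschitz_integral_unique (A : R -> R -> R) (mu : probability (planeT R) R)
    (h : planeT R -> R) : is_copula A -> is_copula_measure A mu -> square_lipschitz h ->
  \int[copula_measure A]_(p in S) h p = \int[mu]_(p in S) h p.
Proof.
move=> cA muA lh; set u := LHS; set v := RHS.
have approx n : `|u - v| <= 4 * n.+1%:R^-1.
  have := riemann_approx cA (copula_measureP cA) n lh; have := riemann_approx cA muA n lh.
  rewrite -/u -/v distrC => hv hu.
  apply: le_trans (ler_distD (riemann_sum n h A) _ _) _.
  by move: hu hv; move: (n.+1%:R^-1) => c; lra.
apply/eqP; rewrite -subr_eq0 -normr_eq0 eq_le normr_ge0 andbT.
apply/ler_addgt0Pr => e e0; rewrite add0r.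
have e4 : 0 < e / 4 by lra.
have [n _ /(_ n (leqnn n))/=] := near_infty_natSinv_lt (PosNum e4).
by have := approx n; move: (n.+1%:R^-1) => c; lra.
Qed.

End concordance_integrals.

Section copula_space.
Context {R : realType}.
Local Notation S := (unit_square R : set (planeT R)).
Local Notation E := (prod_topology (fun _ : R * R => R)).

Definition uncurried (f : E) (x y : R) : R := f (x, y).

(** Asking for values in [[0, 1]] off the square as well makes this a subset of
    a product of compact spaces. *)
Definition copula_set : set E :=
  [set f | (forall p, unit_interval R (f p)) /\ is_copula (uncurried f)].

Lemma continuous_eval p : continuous (fun f : E => f p).
Proof. exact: (@proj_continuous (R * R)%type (fun=> R) p). Qed.

Lemma continuous_volume p1 p2 p3 p4 :
  continuous (fun f : E => f p1 - f p2 - f p3 + f p4).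
Proof.
move=> f; have ev p : (fun g : E => g p) @ f --> f p := @continuous_eval p f.
exact: (cvgD (cvgB (cvgB (ev p1) (ev p2)) (ev p3)) (ev p4)).
Qed.

Lemma closed_is_copula : closed [set f : E | is_copula (uncurried f)].
Proof.
have closed_forall I (D : set I) (P : I -> set E) :
    (forall i, D i -> closed (P i)) -> closed [set f | forall i, D i -> P i f].
  exact: closed_bigI.
have pre_closed (F : E -> R) C : continuous F -> closed C -> closed [set f : E | C (F f)].
  by move=> cF clC; have := (continuous_closedP _).1 cF _ clC.
have eval_closed p C : closed C -> closed [set f : E | C (f p)].
  by apply: pre_closed; exact: continuous_eval.
have eval_eq p (c : R) : closed [set f : E | f p = c].
  by have := eval_closed p [set x | x = c] (@closed_eq _ c).
pose vol (b : R * R * R * R) (f : E) := f (b.1.1.2, b.2) - f (b.1.1.1, b.2)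
  - f (b.1.1.2, b.1.2) + f (b.1.1.1, b.1.2).
have cvol b : continuous (vol b) by exact: continuous_volume.
rewrite (_ : mkset _ =
  [set f : E | forall p, unit_square R p -> unit_interval R (f p)] `&`
  [set f : E | forall x, unit_interval R x -> f (x, 0) = 0] `&`
  [set f : E | forall x, unit_interval R x -> f (0, x) = 0] `&`
  [set f : E | forall x, unit_interval R x -> f (x, 1) = x] `&`
  [set f : E | forall x, unit_interval R x -> f (1, x) = x] `&`
  [set f : E | forall b : R * R * R * R,
     [/\ 0 <= b.1.1.1, b.1.1.1 <= b.1.1.2 & b.1.1.2 <= 1] /\
     [/\ 0 <= b.1.2, b.1.2 <= b.2 & b.2 <= 1] ->
     0 <= vol b f]); last first.
  apply/seteqP; split => f.
    move=> [f01 fx0 f0y fx1 f1y f2]; do !split => //=.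
      by move=> [x y] [x01 y01]; exact: f01.
    by move=> [[[x1 x2] y1] y2] /= [[? ? ?] [? ? ?]]; exact: f2.
  move=> [[[[[f01 fx0] f0y] fx1] f1y] f2]; split => //.
    by move=> x y x01 y01; exact: (f01 (x, y)).
  by move=> x1 x2 y1 y2 *; exact: (f2 (x1, x2, y1, y2)).
apply: closedI; last first.
  by apply: closed_forall => b _; have := pre_closed (vol b) _ (cvol b) (@closed_ge _ 0).
do 4![apply: closedI; last by apply: closed_forall => x _; exact: eval_eq].
apply: closed_forall => p _; apply: eval_closed.
by apply: compact_closed; [exact: norm_hausdorff|exact: segment_compact].
Qed.

Lemma compact_copula_set : compact copula_set.
Proof.
apply: compact_closedI closed_is_copula.
apply: (@tychonoff _ _ (fun=> unit_interval R)) => _.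
exact: segment_compact.
Qed.

Lemma continuous_riemann_sum n (h : E -> planeT R -> R) :
  (forall p, continuous (h ^~ p)) ->
  continuous (fun f : E => riemann_sum n (h f) (uncurried f)).
Proof.
move=> ch; have cvol ij : continuous (fun f : E => @box_volume R n (extend (uncurried f)) ij).
  exact: (@continuous_volume (clamp (node ij.1), clamp (node ij.2))).
apply: (@continuous_big _ _ +%R 0); first exact: add_continuous.
move=> ij _ f.
exact: (cvgM (ch _ f) (cvol ij f)).
Qed.

(** A uniform limit of Riemann sums, which are continuous for pointwise
    convergence. *)
Lemma continuous_copula_integral (h : E -> planeT R -> R) :
  (forall p, continuous (h ^~ p)) -> (forall f, copula_set f -> square_lipschitz (h f)) ->
  {within copula_set, continuous
    (fun f : E => \int[copula_measure (uncurried f)]_(p in S) h f p)}.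
Proof.
move=> ch lh; apply/subspace_continuousP => f Kf.
apply/cvgrPdist_lt => e e0; have e8 : 0 < e / 8 by lra.
have [n _ /(_ n (leqnn n))/=] := near_infty_natSinv_lt (PosNum e8) => /= ne.
have approx g : copula_set g -> `|\int[copula_measure (uncurried g)]_(p in S) h g p
    - riemann_sum n (h g) (uncurried g)| < e / 4.
  move=> Kg; apply: le_lt_trans (riemann_approx Kg.2 (copula_measureP Kg.2) n (lh _ Kg)) _.
  by move: ne; move: (n.+1%:R^-1) => c; lra.
have e4 : 0 < e / 4 by lra.
have rn := (cvgrPdist_lt _ _).1 (@continuous_riemann_sum n h ch f) _ e4.
near=> g.
have Kg : copula_set g by near: g; exact: withinT.
have rg : `|riemann_sum n (h f) (uncurried f) - riemann_sum n (h g) (uncurried g)| < e / 4.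
  by near: g; apply: cvg_within; exact: rn.
have := approx f Kf; have := approx g Kg.
move: rg; set a := Rintegral _ _ _; set b := Rintegral _ _ _.
set c := riemann_sum _ _ _; set d := riemann_sum _ _ _ => rg bg af.
apply: le_lt_trans (ler_distD c _ _) _.
apply: le_lt_trans (lerD (lexx _) (ler_distD d _ _)) _.
by rewrite distrC in bg; lra.
Unshelve. all: by end_near. Qed.

End copula_space.

Section region_compact.
Context {R : realType}.
Local Notation S := (unit_square R : set (planeT R)).
Local Notation E := (prod_topology (fun _ : R * R => R)).

Lemma eq_copula_measure (A A' : R -> R -> R) :
  (forall x y, unit_interval R x -> unit_interval R y -> A x y = A' x y) ->
  copula_measure A = copula_measure A'.
Proof.
move=> AA'; rewrite /copula_measure; congr (xget _ _).
by apply/seteqP; split => mu /= muA x y x01 y01; rewrite muA// AA'.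
Qed.

Lemma eq_kendall_tau (A A' : R -> R -> R) :
  (forall x y, unit_interval R x -> unit_interval R y -> A x y = A' x y) ->
  kendall_tau A = kendall_tau A'.
Proof.
move=> AA'; rewrite /kendall_tau (eq_copula_measure AA').
by congr (_ * _ - _); apply: eq_Rintegral => p; rewrite inE => -[p1 p2]; exact: AA'.
Qed.

Lemma eq_spearman_rho (A A' : R -> R -> R) :
  (forall x y, unit_interval R x -> unit_interval R y -> A x y = A' x y) ->
  spearman_rho A = spearman_rho A'.
Proof. by move=> AA'; rewrite /spearman_rho (eq_copula_measure AA'). Qed.

Lemma eq_is_copula (A A' : R -> R -> R) :
  (forall x y, unit_interval R x -> unit_interval R y -> A x y = A' x y) ->
  is_copula A -> is_copula A'.
Proof.
move=> AA' [r x0 y0 x1 y1 inc].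
have i0 : unit_interval R (0 : R) by rewrite /unit_interval /= in_itv /= lexx ler01.
have i1 : unit_interval R (1 : R) by rewrite /unit_interval /= in_itv /= lexx ler01.
split; try by move=> *; rewrite -AA'; auto.
move=> a1 a2 b1 b2 a10 a12 a21 b10 b12 b21; rewrite -!AA' ?inc//;
  rewrite /unit_interval /= in_itv/=; apply/andP; split => //; lra.
Qed.

(** Every copula agrees on the square with its clamped extension, and tau and rho
    only see the square. *)
Lemma tau_rho_regionE : tau_rho_region R =
  (fun f : E => (kendall_tau (uncurried f), spearman_rho (uncurried f))) @` copula_set.
Proof.
apply/seteqP; split => [_ [A /= cA <-]|_ [f [_ cf] <-]]; last by exists (uncurried f).
pose f : E := fun p => extend A p.1 p.2.
have fA x y : unit_interval R x -> unit_interval R y -> A x y = uncurried f x y.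
  by move=> x01 y01; rewrite /uncurried /f /= extendE.
exists f; last by rewrite -(eq_kendall_tau fA) -(eq_spearman_rho fA).
split; last exact: eq_is_copula cA.
by move=> p; apply: (copula_range cA); exact: clamp_itv.
Qed.

Lemma compact_tau_rho_region : compact (tau_rho_region R).
Proof.
rewrite tau_rho_regionE; apply: continuous_compact; last exact: compact_copula_set.
have ctau := @continuous_copula_integral R (fun f p => uncurried f p.1 p.2)
  (fun p => @continuous_eval R (p.1, p.2))
  (fun f Kf => copula_square_lipschitz Kf.2).
have cst_cont (c : R) : continuous (fun _ : E => c) := @cst_continuous _ _ c.
have crho := @continuous_copula_integral R (fun f p => p.1 * p.2) (fun p => cst_cont (p.1 * p.2))
  (fun f Kf => mul_square_lipschitz).
apply/subspace_continuousP => f Kf.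
have {}ctau := (subspace_continuousP _ _).1 ctau f Kf.
have {}crho := (subspace_continuousP _ _).1 crho f Kf.
have cst (c : R) : (fun=> c) @ within copula_set (nbhs f) --> c by exact: cvg_cst.
exact: cvg_pair (cvgB (cvgM (cst 4) ctau) (cst 1)) (cvgB (cvgM (cst 12) crho) (cst 3)).
Qed.

End region_compact.

(** * Ordinal sums with the minimum copula *)

Section ordinal_sum.
Context {R : realType}.
Variables (s : R) (A : R -> R -> R) (cA : is_copula A).
Hypotheses (s0 : 0 <= s) (s1 : s <= 1).

Lemma min_volume_ge0 (x1 x2 y1 y2 : R) : x1 <= x2 -> y1 <= y2 ->
  0 <= Num.min x2 y2 - Num.min x1 y2 - Num.min x2 y1 + Num.min x1 y1.
Proof.
move=> x12 y12; case: (leP x2 y2) => ?; case: (leP x1 y2) => ?;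
  case: (leP x2 y1) => ?; case: (leP x1 y1) => ?; lra.
Qed.

(** With [upper_part], this splits [x >= 0] as [s * lower_part x + upper_part x],
    the contributions of [[0, s]] and [[s, 1]].  It is 0 when [s = 0]. *)
Definition lower_part (x : R) : R := Num.min x s / s.

Definition upper_part (x : R) : R := Num.max 0 (x - s).

(** On the square of side [s] this is the rescaled copula [A]; when one of the
    coordinates exceeds [s] it is the minimum of the two.  This form avoids
    the case distinction and includes [s = 0], where it is the minimum. *)
Definition ordinal_sum (x y : R) : R :=
  s * A (lower_part x) (lower_part y) + Num.min (upper_part x) (upper_part y).

Lemma scale_lower_part x : 0 <= x -> s * lower_part x = Num.min x s.
Proof.
move=> x0; rewrite /lower_part; have [s_0|sn0] := eqVneq s 0; last by rewrite mulrC divfK.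
by rewrite s_0 mul0r min_r.
Qed.

Lemma lower_part_nd x y : x <= y -> lower_part x <= lower_part y.
Proof. by move=> xy; rewrite ler_wpM2r ?invr_ge0// le_min !ge_min xy lexx orbT. Qed.

Lemma lower_part_itv x : 0 <= x -> unit_interval R (lower_part x).
Proof.
move=> x0; rewrite /unit_interval /= in_itv/= /lower_part divr_ge0 ?le_min ?x0//=.
have [s_0|sn0] := eqVneq s 0; first by rewrite s_0 invr0 mulr0.
by rewrite ler_pdivrMr ?mul1r ?ge_min ?lexx ?orbT// lt_def sn0.
Qed.

Lemma lower_upper_part x : 0 <= x -> Num.min x s + upper_part x = x.
Proof. by move=> x0; rewrite /upper_part; case: (leP x s) => ?; case: leP; lra. Qed.

Lemma upper_part_nd x y : x <= y -> upper_part x <= upper_part y.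
Proof. by move=> xy; rewrite /upper_part; case: (leP 0 (x - s)) => ?; case: (leP 0 (y - s)); lra. Qed.

Lemma upper_part_ge0 x : 0 <= upper_part x.
Proof. by rewrite /upper_part le_max lexx. Qed.

Lemma upper_part_0 : upper_part 0 = 0.
Proof. by rewrite /upper_part max_l// sub0r oppr_le0. Qed.

Lemma lower_part_0 : lower_part 0 = 0.
Proof. by rewrite /lower_part min_l// mul0r. Qed.

Lemma ordinal_sum_copula : is_copula ordinal_sum.
Proof.
have pos x : unit_interval R x -> 0 <= x by rewrite /unit_interval /= in_itv/= => /andP[].
have le1 x : unit_interval R x -> x <= 1 by rewrite /unit_interval /= in_itv/= => /andP[].
have low x : unit_interval R x -> unit_interval R (lower_part x).
  by move=> /pos; exact: lower_part_itv.
have low1 : s = 0 \/ lower_part 1 = 1.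
  have [|sn0] := eqVneq s 0; [by left|right].
  by rewrite /lower_part min_r// divff.
have i1 : unit_interval R (1 : R) by rewrite /unit_interval /= in_itv /= lexx ler01.
have sumx1 x : unit_interval R x -> ordinal_sum x 1 = x.
  move=> x01; rewrite /ordinal_sum min_l ?upper_part_nd ?le1//.
  rewrite -[RHS](lower_upper_part (pos _ x01)) -scale_lower_part ?pos//.
  by case: low1 => ->; rewrite ?mul0r// (copula_x1 cA)//; exact: low.
have sum1x x : unit_interval R x -> ordinal_sum 1 x = x.
  move=> x01; rewrite /ordinal_sum min_r ?upper_part_nd ?le1//.
  rewrite -[RHS](lower_upper_part (pos _ x01)) -scale_lower_part ?pos//.
  by case: low1 => ->; rewrite ?mul0r// (copula_1y cA)//; exact: low.
have inc x1 x2 y1 y2 : 0 <= x1 -> x1 <= x2 -> x2 <= 1 -> 0 <= y1 -> y1 <= y2 -> y2 <= 1 ->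
    0 <= ordinal_sum x2 y2 - ordinal_sum x1 y2 - ordinal_sum x2 y1 + ordinal_sum x1 y1.
  move=> x10 x12 x21 y10 y12 y21.
  have ux x : 0 <= x -> 0 <= lower_part x <= 1.
    by move=> /lower_part_itv; rewrite /unit_interval /= in_itv.
  have := min_volume_ge0 (upper_part_nd x12) (upper_part_nd y12).
  have /(mulr_ge0 s0) : 0 <= A (lower_part x2) (lower_part y2) - A (lower_part x1) (lower_part y2)
      - A (lower_part x2) (lower_part y1) + A (lower_part x1) (lower_part y1).
    have /andP[? ?] := ux _ x10; have /andP[? ?] := ux _ y10.
    have /andP[? ?] := ux _ (le_trans x10 x12); have /andP[? ?] := ux _ (le_trans y10 y12).
    by apply: (copula_2increasing cA) => //; exact: lower_part_nd.
  by rewrite /ordinal_sum mulrDr !mulrBr; lra.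
have sumx0 x : unit_interval R x -> ordinal_sum x 0 = 0.
  move=> x01; rewrite /ordinal_sum lower_part_0 upper_part_0 (copula_x0 cA); last exact: low.
  by rewrite mulr0 add0r min_r// upper_part_ge0.
have sum0x x : unit_interval R x -> ordinal_sum 0 x = 0.
  move=> x01; rewrite /ordinal_sum lower_part_0 upper_part_0 (copula_0y cA); last exact: low.
  by rewrite mulr0 add0r min_l// upper_part_ge0.
split; [|exact: sumx0|exact: sum0x|exact: sumx1|exact: sum1x|exact: inc].
move=> x y x01 y01; rewrite /unit_interval /= in_itv/=; apply/andP; split.
  have := inc 0 x 0 y (lexx _) (pos _ x01) (le1 _ x01) (lexx _) (pos _ y01) (le1 _ y01).
  rewrite sumx0// sum0x// sumx0//; first by lra.
  by rewrite /unit_interval /= in_itv/= lexx ler01.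
have := inc 0 x y 1 (lexx _) (pos _ x01) (le1 _ x01) (pos _ y01) (le1 _ y01) (lexx _).
by rewrite sumx1// !sum0x//; have := le1 _ x01; lra.
Qed.

End ordinal_sum.

Section ordinal_sum_measure.
Context {R : realType}.
Variable s : R.
Hypotheses (s0 : 0 <= s) (s1 : s <= 1).
Local Notation U := (@unif01 R).
Local Notation S := (unit_square R : set (planeT R)).

Definition shrink (p : planeT R) : planeT R := (s * p.1, s * p.2).

Lemma shrink_square : S `<=` shrink @^-1` S.
Proof.
move=> [x y] [/= + +]; rewrite /shrink /unit_square /unit_interval /= !in_itv/=.
by move=> /andP[x0 x1] /andP[y0 y1]; split => /=; rewrite ?in_itv/= mulr_ge0//= mulr_ile1.
Qed.

Lemma measurable_shrink : measurable_fun setT shrink.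
Proof.
by apply: measurable_fun_pair; apply: measurable_funM => //; exact: measurable_cst.
Qed.

HB.instance Definition _ := isMeasurableFun.Build _ _ _ _ shrink measurable_shrink.

Definition diagonal (t : measurableTypeR R) : planeT R := (t, t).

Lemma measurable_diagonal : measurable_fun setT diagonal.
Proof. exact: measurable_fun_pair. Qed.

HB.instance Definition _ := isMeasurableFun.Build _ _ _ _ diagonal measurable_diagonal.

Definition above : set (planeT R) := `]s, 1]%classic `*` setT.

Lemma measurable_above : measurable above.
Proof. by apply: measurableX => //; exact: measurable_itv. Qed.

(** The part of the ordinal sum above [s]: the uniform law on [0, 1], restricted
    to the points above [s] and carried to the diagonal.  It does not depend on the copula [A]. *)
Definition diagonal_above := mrestr (distribution U diagonal) measurable_above.
HB.instance Definition _ := Measure.on diagonal_above.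

Lemma diagonal_above_box a b : 0 <= a -> a <= 1 -> 0 <= b -> b <= 1 ->
  diagonal_above (`[0, a]%classic `*` `[0, b]%classic) =
  (Num.min (upper_part s a) (upper_part s b))%:E.
Proof.
move=> a0 a1 b0 b1; rewrite /diagonal_above /mrestr /distribution /pushforward /=.
rewrite (_ : _ @^-1` _ = `]s, Num.min a b]%classic); last first.
  apply/seteqP; split => t; rewrite /diagonal /above /= !in_itv/=.
    by move=> [[/andP[_ ta] /andP[_ tb]] [/andP[st _] _]]; rewrite st le_min ta tb.
  move=> /andP[st]; rewrite le_min => /andP[ta tb].
  have t0 : 0 <= t by exact: le_trans s0 (ltW st).
  by rewrite t0 ta tb st (le_trans ta a1).
have mE : Num.min (upper_part s a) (upper_part s b) = Num.max 0 (Num.min a b - s).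
  rewrite /upper_part; case: (leP a b) => ab; case: (leP 0 (a - s)) => as';
    case: (leP 0 (b - s)) => bs'; case: leP; lra.
rewrite mE; have m0 : 0 <= Num.min a b by rewrite le_min a0.
have m1 : Num.min a b <= 1 by rewrite ge_min a1.
have [sm|ms] := leP s (Num.min a b); last first.
  rewrite set_itv_ge ?measure0; last by rewrite bnd_simp -leNgt ltW.
  by rewrite max_l//; lra.
by rewrite unif01_oc// !clamp_id// max_r//; lra.
Qed.

Lemma diagonal_aboveT : diagonal_above setT = (1 - s)%:E.
Proof.
rewrite /diagonal_above /mrestr /distribution /pushforward setTI.
rewrite (_ : _ @^-1` _ = `]s, 1]%classic); last first.
  by apply/seteqP; split => t; rewrite /diagonal /above /=; [case|].
by rewrite unif01_oc// !clamp_id.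
Qed.

Lemma measurable_diff0 : measurable [set p : planeT R | p.1 - p.2 = 0].
Proof.
have /(_ measurableT [set 0] (measurable_set1 _)) : measurable_fun setT (fun p : planeT R => p.1 - p.2).
  exact: measurable_funB.
by rewrite setTI.
Qed.

Lemma diagonal_above_ae : \forall p \ae diagonal_above, p.1 = p.2 /\ s < p.1.
Proof.
pose D : set (planeT R) := [set p | p.1 - p.2 = 0] `&` above.
have mD : measurable D by apply: measurableI; [exact: measurable_diff0|exact: measurable_above].
exists (~` D); split; first exact: measurableC.
- rewrite /diagonal_above /mrestr /distribution /pushforward (_ : _ @^-1` _ = set0) ?measure0//.
  apply/seteqP; split => // t [Dt At]; apply: Dt; split => //.
  by rewrite /diagonal /= subrr.
- move=> p /= pN [p12 [/= + _]]; rewrite in_itv/= => /andP[sp _]; apply: pN.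
  by split => //; exact: subr0_eq.
Qed.

Section measure.
Variable mu : probability (planeT R) R.

Definition ordinal_sum_measure : set (planeT R) -> \bar R :=
  measure_add (mscale (NngNum s0) (distribution mu shrink)) diagonal_above.
HB.instance Definition _ := Measure.on ordinal_sum_measure.

Lemma ordinal_sum_measureE E :
  ordinal_sum_measure E = (s%:E * mu (shrink @^-1` E) + diagonal_above E)%E.
Proof. by rewrite /ordinal_sum_measure measure_addE. Qed.

Lemma ordinal_sum_measureT : ordinal_sum_measure setT = 1%E.
Proof.
rewrite ordinal_sum_measureE diagonal_aboveT preimage_setT probability_setT mule1.
by rewrite -EFinD subrKC.
Qed.

HB.instance Definition _ := Measure_isProbability.Build _ _ _ ordinal_sum_measure ordinal_sum_measureT.

Variables (A : R -> R -> R) (cA : is_copula A) (muA : is_copula_measure A mu).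

Lemma ordinal_sum_measureP : is_copula_measure (ordinal_sum s A) ordinal_sum_measure.
Proof.
move=> a b a01 b01; rewrite [LHS]ordinal_sum_measureE.
move: (a01) (b01); rewrite /unit_interval /= !in_itv/= => /andP[a0 a1] /andP[b0 b1].
rewrite diagonal_above_box// /ordinal_sum [RHS]EFinD; congr (_ + _)%E; rewrite EFinM.
have [->|sn0] := eqVneq s 0; first by rewrite !mul0e.
have sgt0 : 0 < s by rewrite lt_def sn0.
rewrite -muA; [|exact: lower_part_itv..]; congr (_ * _)%E.
rewrite -[LHS](probability_setI_full measurable_unit_square _ (copula_measure_square cA muA)); last first.
  rewrite -[X in measurable X]setTI; apply: measurable_shrink => //; exact: measurable_box.
have mem x c : 0 <= x -> x <= 1 -> 0 <= c -> (s * x <= c) = (x <= lower_part s c).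
  move=> x0 x1 c0; rewrite /lower_part ler_pdivlMr// mulrC le_min.
  by rewrite andb_idr// => _; rewrite ler_piMl.
congr (mu _); apply/seteqP; split => -[x y]; rewrite /shrink /unit_square /unit_interval /=.
  move=> [[+ +] [+ +]] /=; rewrite !in_itv/= => /andP[_ xa] /andP[_ yb] /andP[x0 x1] /andP[y0 y1].
  by rewrite x0 y0 -!mem.
rewrite !in_itv/= => -[/andP[x0 xa] /andP[y0 yb]].
have le1 z c : 0 <= c -> z <= lower_part s c -> z <= 1.
  move=> /(lower_part_itv s0); rewrite /unit_interval /= in_itv/= => /andP[_ c1] zc.
  exact: le_trans c1.
have x1 := le1 _ _ a0 xa; have y1 := le1 _ _ b0 yb.
by split; split; rewrite /= ?in_itv/= ?mem// ?x0 ?y0 ?xa ?yb ?x1 ?y1 ?mulr_ge0.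
Qed.

Lemma integral_ordinal_sum (h : planeT R -> R) : square_lipschitz h ->
  (forall p, S p -> 0 <= h p) ->
  \int[ordinal_sum_measure]_(p in S) h p =
  s * \int[mu]_(p in S) h (shrink p) + \int[diagonal_above]_(p in S) h p.
Proof.
move=> lh h0.
have mS := @measurable_unit_square R.
have mh : measurable_fun S (EFin \o h) by apply/measurable_EFinP; exact: square_lipschitz_measurable.
have mSS : measurable (shrink @^-1` S).
  by rewrite -[X in measurable X]setTI; exact: measurable_shrink.
have mhs : measurable_fun (shrink @^-1` S) (EFin \o h \o shrink).
  apply: (measurable_comp mS _ mh) => //; first by move=> _ [p Sp <-].
  exact: measurable_funTS measurable_shrink.
have muSC : mu (~` S) = 0%E.
  by rewrite probability_setC// [X in (_ - X)%E](copula_measure_square cA muA) subee.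
have E1 : (\int[ordinal_sum_measure]_(p in S) (h p)%:E =
    s%:E * \int[mu]_(p in S) (h (shrink p))%:E + \int[diagonal_above]_(p in S) (h p)%:E)%E.
  rewrite ge0_integral_measure_add//.
  rewrite ge0_integral_mscale//.
  congr (_ * _ + _)%E.
  rewrite /distribution ge0_integral_pushforward//; last by move=> p; rewrite inE; exact: h0.
  rewrite (ge0_negligible_integral (measurableC mS))//; last first.
    by move=> p Sp; rewrite lee_fin h0.
  by congr (integral _ _ _); rewrite setDE setCK; exact/setIidr/shrink_square.
have lhs : square_lipschitz (h \o shrink).
  move=> p q Sp Sq; apply: le_trans (lh _ _ (shrink_square Sp) (shrink_square Sq)) _.
  rewrite /shrink /= -!mulrBr !normrM ger0_norm//.
  by apply: lerD; rewrite ler_piMl.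
have f1 := integrable_fin_num mS (square_lipschitz_integrable mu lhs).
have := integrable_fin_num mS (square_lipschitz_integrable ordinal_sum_measure lh).
rewrite /Rintegral /= E1 fin_numD => /andP[_ f2].
by rewrite fineD ?fin_numM// fineM.
Qed.

End measure.

Lemma ordinal_sum_diagonal (A : R -> R -> R) t : is_copula A -> s < t ->
  ordinal_sum s A t t = t.
Proof.
move=> cA st; rewrite /ordinal_sum minxx /lower_part /upper_part min_r ?(ltW st)// max_r ?subr_ge0 ?(ltW st)//.
have [->|sn0] := eqVneq s 0; first by rewrite mul0r add0r subr0.
rewrite divff// (copula_x1 cA) ?mulr1 ?subrKC//.
by rewrite /unit_interval /= in_itv/= lexx ler01.
Qed.

(** One factor [s] is the mass of the lower part, the other one comes from
    [A_s (s x) (s y) = s A x y].  On the diagonal above [s] the ordinal sum is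
    equal to the abscissa, so that the last term only depends on [s]. *)
Lemma integral_self_ordinal_sum (A : R -> R -> R) : is_copula A ->
  \int[copula_measure (ordinal_sum s A)]_(p in S) ordinal_sum s A p.1 p.2 =
  s ^+ 2 * \int[copula_measure A]_(p in S) A p.1 p.2 + \int[diagonal_above]_(p in S) p.1.
Proof.
move=> cA; have cAs := ordinal_sum_copula cA s0 s1.
have muA := copula_measureP cA; have lA := copula_square_lipschitz cA.
have lAs := copula_square_lipschitz cAs.
have mS := @measurable_unit_square R.
rewrite (square_lipschitz_integral_unique cAs (ordinal_sum_measureP cA muA) lAs).
rewrite (integral_ordinal_sum cA muA lAs); last first.
  by move=> p [p1 p2]; have := copula_range cAs p1 p2; rewrite /unit_interval /= in_itv/= => /andP[].
congr (_ + _).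
  have [->|sn0] := eqVneq s 0; first by rewrite mul0r expr0n mul0r.
  rewrite expr2 -mulrA; congr (_ * _).
  rewrite -RintegralZl//; last exact: square_lipschitz_integrable.
  apply: eq_Rintegral => p; rewrite inE => -[p1 p2]; rewrite /shrink /ordinal_sum /=.
  have low x : unit_interval R x -> lower_part s (s * x) = x.
    rewrite /unit_interval /= in_itv/= => /andP[x0 x1].
    by rewrite /lower_part min_l ?ler_piMr// mulrC mulKf.
  have up x : unit_interval R x -> upper_part s (s * x) = 0.
    rewrite /unit_interval /= in_itv/= => /andP[x0 x1].
    by rewrite /upper_part max_l// subr_le0 ler_piMr.
  by rewrite !low// !up// minxx addr0.
have mAs := square_lipschitz_measurable lAs.
congr fine; apply: ae_eq_integral => //.
- exact/measurable_EFinP.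
- by apply/measurable_EFinP; apply: measurable_funTS.
- have [N [mN N0 subN]] := diagonal_above_ae; exists N; split => // p /= pN.
  apply: subN => /= -[p12 sp]; apply: pN => -[p1 _]; congr EFin; rewrite -p12.
  exact: ordinal_sum_diagonal.
Qed.

Lemma integral_mul_ordinal_sum (A : R -> R -> R) : is_copula A ->
  \int[copula_measure (ordinal_sum s A)]_(p in S) (p.1 * p.2) =
  s ^+ 3 * \int[copula_measure A]_(p in S) (p.1 * p.2) +
  \int[diagonal_above]_(p in S) (p.1 * p.2).
Proof.
move=> cA; have cAs := ordinal_sum_copula cA s0 s1.
have muA := copula_measureP cA; have lm := @mul_square_lipschitz R.
have mS := @measurable_unit_square R.
rewrite (square_lipschitz_integral_unique cAs (ordinal_sum_measureP cA muA) lm).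
rewrite (integral_ordinal_sum cA muA lm); last first.
  move=> p [+ +]; rewrite /unit_interval /= !in_itv/= => /andP[p0 _] /andP[q0 _].
  exact: mulr_ge0.
congr (_ + _); rewrite exprS -mulrA; congr (_ * _).
rewrite -RintegralZl//; last exact: square_lipschitz_integrable.
by apply: eq_Rintegral => p _; rewrite /shrink /= mulrACA.
Qed.

End ordinal_sum_measure.

Section ordinal_sum_min.
Context {R : realType}.

Lemma min_copula : is_copula (Num.min : R -> R -> R).
Proof.
have i1 x : unit_interval R x -> 0 <= x /\ x <= 1.
  by rewrite /unit_interval /= in_itv/= => /andP[].
split => [x y x01 y01|x /i1[]|x /i1[]|x /i1[]|x /i1[]|x1 x2 y1 y2 _ x12 _ _ y12 _].
- by case: leP.
- by move=> *; exact: min_r.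
- by move=> *; exact: min_l.
- by move=> *; exact: min_l.
- by move=> *; exact: min_r.
- exact: min_volume_ge0.
Qed.

Lemma ordinal_sum_min (s x y : R) : 0 <= s -> 0 <= x -> 0 <= y ->
  ordinal_sum s Num.min x y = Num.min x y.
Proof.
move=> s0 x0 y0; rewrite /ordinal_sum minr_pMr// !scale_lower_part//.
wlog xy : x y x0 y0 / x <= y.
  move=> H; have /orP[] := le_total x y; first exact: H.
  by move=> yx; rewrite (minC (Num.min x s)) (minC (upper_part s x)) [RHS]minC H.
rewrite (min_l (upper_part_nd s xy)) [RHS]min_l// min_l ?lower_upper_part//.
by rewrite le_min !ge_min xy lexx !orbT.
Qed.

End ordinal_sum_min.

Section contraction.
Context {R : realType}.

Definition apex : R * R := (kendall_tau Num.min, spearman_rho Num.min).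

(** The point of the region that an ordinal sum of ratio [s] gives, relative to
    the image of the minimum copula. *)
Definition contract (s : R) (z : R * R) : R * R :=
  (apex.1 + s ^+ 2 * (z.1 - apex.1), apex.2 + s ^+ 3 * (z.2 - apex.2)).

(** The ordinal sum of the minimum copula with itself is the minimum copula, so
    the terms that depend on [s] only are eliminated by comparison with it. *)
Lemma contract_region s z : 0 <= s -> s <= 1 -> tau_rho_region R z -> tau_rho_region R (contract s z).
Proof.
move=> s0 s1 [A /= cA <-]; exists (ordinal_sum s A); first exact: ordinal_sum_copula.
have ge0 x : unit_interval R x -> 0 <= x by rewrite /unit_interval /= in_itv/= => /andP[].
have minE x y : unit_interval R x -> unit_interval R y -> ordinal_sum s Num.min x y = Num.min x y.
  by move=> /ge0 x0 /ge0 y0; exact: ordinal_sum_min.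
have := eq_kendall_tau minE; have := eq_spearman_rho minE.
rewrite /contract /apex /= /kendall_tau /spearman_rho.
rewrite !(integral_self_ordinal_sum s0 s1)//; last exact: min_copula.
rewrite !(integral_mul_ordinal_sum s0 s1)//; last exact: min_copula.
by move=> er et; congr (_, _); [move: et|move: er];
  move: (Rintegral _ _ _) (Rintegral _ _ _) (Rintegral _ _ _) => a b c; lra.
Qed.

End contraction.

(** * Contractibility and simple connectedness *)

Section deformation.
Context {R : realType}.
Local Notation Omega := (tau_rho_region R).
Local Notation apex := (@apex R).
Implicit Types (r : R) (z : R * R).

Lemma apex_region : Omega apex.
Proof. by exists Num.min => //; exact: min_copula. Qed.

Lemma contract0 z : contract 0 z = apex.
Proof. by rewrite /contract !expr0n /= !mul0r !addr0. Qed.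

Lemma contract1 z : contract 1 z = z.
Proof. by case: z => a b; rewrite /contract !expr1n !mul1r /= !subrKC. Qed.

Lemma continuous_contract (T : topologicalType) (r : T -> R) (z : T -> R * R) :
  continuous r -> continuous z -> continuous (fun p => contract (r p) (z p)).
Proof.
move=> cr cz p.
have c1 : (fun q => (z q).1) @ p --> (z p).1 by apply: cvg_comp (cz p) _; exact: cvg_fst.
have c2 : (fun q => (z q).2) @ p --> (z p).2 by apply: cvg_comp (cz p) _; exact: cvg_snd.
have cst (c : R) : (fun=> c) @ p --> c by exact: cvg_cst.
have c3 : (fun q => r q ^+ 2) @ p --> r p ^+ 2 by exact: cvgM (cr p) (cr p).
have c4 : (fun q => r q ^+ 3) @ p --> r p ^+ 3 by exact: cvgM (cr p) c3.
exact: cvg_pair (cvgD (cst apex.1) (cvgM c3 (cvgB c1 (cst apex.1))))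
                (cvgD (cst apex.2) (cvgM c4 (cvgB c2 (cst apex.2)))).
Qed.

Lemma continuous_comp_clamp (T : topologicalType) (f : R -> T) :
  {within unit_interval R, continuous f} -> continuous (f \o clamp).
Proof.
move=> /subspace_continuousP cf t.
apply: (@cvg_comp _ _ _ clamp f (nbhs t) (within (unit_interval R) (nbhs (clamp t)))); last first.
  by apply: cf; exact: clamp_itv.
move=> P /= wP; have wP' : nbhs (clamp t) [set x | unit_interval R x -> P x] by exact: wP.
have near_t : nbhs t (fun u => unit_interval R (clamp u) -> P (clamp u)).
  exact: continuous_clamp wP'.
suff : nbhs t (fun u => P (clamp u)) by [].
by apply: filterS near_t => u; apply; exact: clamp_itv.
Qed.

(** The path goes from [x] to the apex and then to [y].  At each time one of the
    two contracted points is the apex, so their sum minus the apex is the other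
    one; this expresses the concatenation by a single continuous formula. *)
Lemma path_connected_region : path_connected R Omega.
Proof.
split; first by exists apex; exact: apex_region.
move=> x y Ox Oy.
have addKK (V : zmodType) (a b : V) : a + b - a = b by rewrite addrC addKr.
pose f t := contract (clamp (1 - 2 * t)) x + contract (clamp (2 * t - 1)) y - apex.
have c2 : continuous (fun t : R => 2 * t).
  by move=> t; exact: cvgM (cvg_cst (2 : R)) (@cvg_id _ _).
have cst (c : R) : continuous (fun _ : R => c) by move=> t; exact: cvg_cst.
have cz (z : R * R) : continuous (fun _ : R => z) by move=> t; exact: cvg_cst.
have cl (g : R -> R) : continuous g -> continuous (fun t => clamp (g t)).
  by move=> cg t; apply: continuous_comp; [exact: cg|exact: continuous_clamp].
have cf : continuous f.
  move=> t; apply: cvgB (cz apex t); apply: cvgD.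
    by apply: continuous_contract (cz x) t; apply: cl => t; exact: cvgB (cst 1 t) (c2 t).
  by apply: continuous_contract (cz y) t; apply: cl => t; exact: cvgB (c2 t) (cst 1 t).
exists f; split.
- exact: continuous_subspaceT.
- move=> _ [t _ <-]; rewrite /f; have [t12|t12] := leP t 2^-1.
    rewrite (@clamp_le0 _ (2 * t - 1)) ?contract0 ?addrK; last lra.
    by apply: contract_region => //; [exact: clamp_ge0|exact: clamp_le1].
  rewrite (@clamp_le0 _ (1 - 2 * t)) ?contract0 ?addKK; last lra.
  by apply: contract_region => //; [exact: clamp_ge0|exact: clamp_le1].
- by rewrite /f mulr0 subr0 sub0r clamp_ge1// contract1 clamp_le0 ?contract0 ?addrK// lerN10.
- rewrite /f mulr1 (@clamp_le0 _ (1 - 2)) ?contract0; last lra.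
  by rewrite clamp_ge1 ?contract1; [exact: addKK|lra].
Qed.

(** The height of the loop that climbs to 1 during the first third of the time
    and comes down during the last one. *)
Definition tent (t : R) : R := Num.min 1 (Num.min (3 * t) (3 - 3 * t)).

Lemma tent_itv t : 0 <= t -> t <= 1 -> 0 <= tent t <= 1.
Proof.
by move=> t0 t1; rewrite /tent !le_min !ge_min lexx ler01/= andbT; apply/andP; split; lra.
Qed.

Section loop.
Variables (x : R * R) (f : R -> R * R).
Hypothesis (fx : is_path Omega x x f).

(** In the first half of the homotopy the loop is pushed towards the apex while
    its middle part is run through faster: at time [s = 1/2] it goes from [x] to
    the apex, follows the loop contracted to the apex, and comes back. *)
Definition shrink_stage (s t : R) : R * R :=
  contract (1 - Num.min (2 * s) (tent t)) (f (clamp ((1 + 4 * s) * t - 2 * s))).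

(** In the second half the resulting path to the apex and back is pulled back
    to [x]. *)
Definition retract_stage (s t : R) : R * R :=
  contract (1 - Num.min (tent t) (2 - 2 * s)) x.

Lemma stages_glue t : 0 <= t -> t <= 1 -> shrink_stage 2^-1 t = retract_stage 2^-1 t.
Proof.
move=> t0 t1; rewrite /shrink_stage /retract_stage.
have /andP[T0 T1] := tent_itv t0 t1; have [_ _ f0 f1] := fx.
rewrite mulfV// min_r// min_l; last by lra.
rewrite (_ : (1 + 4 / 2) * t - 1 = 3 * t - 1); last lra.
have [t3|t3] := leP (3 * t) 1; first by rewrite clamp_le0 ?f0//; lra.
have [t3'|t3'] := leP 2 (3 * t); first by rewrite clamp_ge1 ?f1//; lra.
rewrite /tent min_l ?subrr ?contract0//.
by rewrite le_min; apply/andP; split; lra.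
Qed.

(** Both stages agree at [1/2], so this single expression is the first stage up to
    time [1/2] and the second one afterwards, and it is visibly continuous. *)
Definition loop_homotopy (p : R * R) : R * R :=
  shrink_stage (Num.min p.1 2^-1) p.2 + retract_stage (Num.max p.1 2^-1) p.2 - retract_stage 2^-1 p.2.

Lemma loop_homotopy_shrink s t : s <= 2^-1 -> loop_homotopy (s, t) = shrink_stage s t.
Proof. by move=> s2; rewrite /loop_homotopy /= min_l// max_r// addrK. Qed.

Lemma loop_homotopy_retract s t : 2^-1 <= s -> 0 <= t -> t <= 1 -> loop_homotopy (s, t) = retract_stage s t.
Proof. by move=> s2 t0 t1; rewrite /loop_homotopy /= min_r// max_l// stages_glue// addrC addKr. Qed.

Lemma continuous_loop_homotopy : continuous loop_homotopy.
Proof.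
have [cf _ _ _] := fx; have {}cf := continuous_comp_clamp cf.
have cst (c : R) : continuous (fun _ : R * R => c) by move=> p; exact: cvg_cst.
have cM (g h : R * R -> R) : continuous g -> continuous h -> continuous (fun p => g p * h p).
  by move=> cg ch p; exact: cvgM (cg p) (ch p).
have cD (g h : R * R -> R) : continuous g -> continuous h -> continuous (fun p => g p + h p).
  by move=> cg ch p; exact: cvgD (cg p) (ch p).
have cB (g h : R * R -> R) : continuous g -> continuous h -> continuous (fun p => g p - h p).
  by move=> cg ch p; exact: cvgB (cg p) (ch p).
have cmin (g h : R * R -> R) : continuous g -> continuous h -> continuous (fun p => Num.min (g p) (h p)).
  by move=> cg ch p; apply: continuous_min; [exact: cg|exact: ch].
have cmax (g h : R * R -> R) : continuous g -> continuous h -> continuous (fun p => Num.max (g p) (h p)).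
  by move=> cg ch p; apply: continuous_max; [exact: cg|exact: ch].
have c1 : continuous (fun p : R * R => p.1) by move=> p; exact: cvg_fst.
have c2 : continuous (fun p : R * R => p.2) by move=> p; exact: cvg_snd.
have ctent : continuous (fun p : R * R => tent p.2).
  by apply: (cmin _ _ (cst 1)); apply: (@cmin); [exact: (@cM)|apply: (@cB) => //; exact: (@cM)].
have cstage2 (g : R * R -> R) : continuous g -> continuous (fun p => retract_stage (g p) p.2).
  move=> cg; apply: continuous_contract; last by move=> p; exact: cvg_cst.
  by apply: (@cB) => //; apply: (@cmin) => //; apply: (@cB) => //; exact: (@cM).
have cstage1 (g : R * R -> R) : continuous g -> continuous (fun p => shrink_stage (g p) p.2).
  move=> cg; apply: continuous_contract.
    by apply: (@cB) => //; apply: (@cmin) => //; exact: (@cM).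
  have ch : continuous (fun p : R * R => (1 + 4 * g p) * p.2 - 2 * g p).
    by apply: (@cB); [apply: (@cM) => //; apply: (@cD) => //; exact: (@cM)|exact: (@cM)].
  by move=> p; exact: (@continuous_comp _ _ _ _ (f \o clamp) p (ch p) (cf _)).
have h1 := cstage1 _ (cmin _ _ c1 (cst 2^-1)).
have h2 := cstage2 _ (cmax _ _ c1 (cst 2^-1)).
have h3 := cstage2 _ (cst 2^-1).
by move=> p; exact: cvgB (cvgD (h1 p) (h2 p)) (h3 p).
Qed.

Lemma null_homotopic_region : Omega x -> null_homotopic Omega x f.
Proof.
move=> Ox; have [_ fO f0 f1] := fx.
exists loop_homotopy; split.
- exact/continuous_subspaceT/continuous_loop_homotopy.
- move=> _ [[s t] [+ +] <-]; rewrite /unit_interval /= !in_itv/= => /andP[s0 s1] /andP[t0 t1].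
  have /andP[T0 T1] := tent_itv t0 t1.
  have [s2|/ltW s2] := leP s 2^-1.
    rewrite loop_homotopy_shrink//; apply: contract_region.
    + by rewrite subr_ge0 ge_min T1 orbT.
    + by rewrite gerBl le_min T0 mulr_ge0.
    + by apply: fO; exists (clamp ((1 + 4 * s) * t - 2 * s)) => //; exact: clamp_itv.
  rewrite loop_homotopy_retract//; apply: contract_region => //.
  + by rewrite subr_ge0 ge_min T1.
  + by rewrite gerBl le_min T0/=; lra.
- move=> t /[dup] t01; rewrite /unit_interval /= in_itv/= => /andP[t0 t1].
  have /andP[T0 T1] := tent_itv t0 t1.
  rewrite loop_homotopy_shrink ?invr_ge0// /shrink_stage !mulr0 min_l// subr0 contract1.
  by rewrite addr0 mul1r subr0 clamp_unit.
- move=> t; rewrite /unit_interval /= in_itv/= => /andP[t0 t1].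
  have /andP[T0 T1] := tent_itv t0 t1.
  rewrite loop_homotopy_retract//; last by lra.
  by rewrite /retract_stage mulr1 subrr min_r// subr0 contract1.
- move=> s; rewrite /unit_interval /= in_itv/= => /andP[s0 s1].
  have tent0 : tent 0 = 0 by rewrite /tent mulr0 subr0 (@min_l _ _ 0 3)// min_r.
  have tent1 : tent 1 = 0 by rewrite /tent mulr1 subrr (@min_r _ _ 3 0)// min_r.
  have [s2|/ltW s2] := leP s 2^-1.
    rewrite !loop_homotopy_shrink// /shrink_stage tent0 tent1 min_r ?mulr_ge0// subr0 !contract1 mulr0 mulr1.
    by rewrite clamp_le0 ?f0; [rewrite clamp_ge1 ?f1//|]; lra.
  rewrite !loop_homotopy_retract// /retract_stage tent0 tent1 min_l; last by lra.
  by rewrite subr0 contract1.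
Qed.

End loop.

Lemma simply_connected_region : simply_connected R Omega.
Proof.
split; first exact: path_connected_region.
by move=> x f Ox fx; exact: null_homotopic_region.
Qed.

End deformation.

Theorem mainTheorem5 (R : realType) :
  compact (tau_rho_region R) /\ simply_connected R (tau_rho_region R).
Proof. by split; [exact: compact_tau_rho_region|exact: simply_connected_region]. Qed.
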